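(* Let $\alpha>0$, let $G(x)=x_1\vee\alpha x_2$ for $x\in\mathbb R_+^2$ and let $\Delta=\{x\in\mathbb R_+^2: x_1=\alpha x_2\}$. Let $b$, $\sigma$, $c$, $r$ satisfy the standing assumptions stated in the context. Then $$\Gamma:=c+rG-\mathcal LG$$ is a signed Radon measure on $\mathbb R_+^2$. On $\mathbb R_+^2\setminus\Delta$ it is absolutely continuous (with respect to Lebesgue measure) with density $$\Gamma^{\rm ac}(x)=c(x)+rG(x)-b_1(x)\mathbf 1_{\{x_1>\alpha x_2\}}-\alpha b_2(x)\mathbf 1_{\{x_1<\alpha x_2\}} .$$ Its singular component on the diagonal is $$\Gamma^\Delta(dx)=-\frac{(1,-\alpha)\,a(x)\,(1,-\alpha)^\top}{2\sqrt{1+\alpha^2}}\,\sigma_\Delta(dx).$$ Consequently, $\Gamma(dx)=\Gamma^{\rm ac}(x)\,dx+\Gamma^\Delta(dx)$.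
   Context: $\mathbb R_+^2=[0,\infty)^2$. $b=(b_1,b_2):\mathbb R_+^2\to\mathbb R^2$ is the drift and $\sigma:\mathbb R_+^2\to\mathbb R^{2\times2}$ the volatility of a diffusion $X$ in $\mathbb R_+^2$ with normal reflection, $dX_t=b(X_t)dt+\sigma(X_t)dW_t+dL_t$, where $W$ is a two-dimensional Brownian motion, and each $L^i$ is continuous, adapted, nondecreasing, with $L^i_0=0$ and $\int_0^\infty \mathbf 1_{\{X^i_s>0\}}dL^i_s=0$. Set $a(x)=\sigma(x)\sigma(x)^\top$. $\sigma_\Delta$ denotes one-dimensional surface (arc-length) measure on $\Delta$. Standing assumptions. (A1) $b,\sigma$ are continuous and locally Lipschitz, $|b(x)|+|\sigma(x)|\le K(1+|x|)$ for some $K>0$, $a$ is locally uniformly elliptic in $(0,\infty)^2$, and the reflected SDE has a unique strong solution for every initial point $x\in\mathbb R_+^2$. (A2) $c:\mathbb R_+^2\to[0,\infty)$ is continuous with at most polynomial growth, $r>0$, and for every $x$: $\mathbb E_x[\int_0^\infty e^{-rs}c(X_s)ds]<\infty$ and $\mathbb E_x[\sup_{t\ge0}e^{-rt}G(X_t)]<\infty$. (A3) There are $\Psi\in C^2(\mathbb R_+^2)$, $K_\Psi,\lambda_\Psi>0$ and $m\ge1$ with $1+|x|^m\le K_\Psi\Psi(x)$, $G(x)+c(x)\le K_\Psi\Psi(x)$, and $\mathcal L\Psi(x)\le\lambda_\Psi\Psi(x)+K_\Psi$ on $(0,\infty)^2$, and $r>\lambda_\Psi$. For smooth $f$, $\mathcal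 Lf=b\cdot\nabla f+\tfrac12\operatorname{Tr}(aD^2f)$. For the nonsmooth function $G$, $\mathcal LG$ is understood in the sense of distributions: $\nabla G$ is the almost-everywhere defined weak gradient, and $D^2G$ is the distributional Hessian of $G$, tested against $\varphi\in C_c^\infty((0,\infty)^2)$; when $D^2G$ is a (matrix-valued) Radon measure, $\mathcal LG$ is the measure $b\cdot\nabla G\,dx+\tfrac12\operatorname{Tr}(a(x)D^2G(dx))$. The functions $c+rG$ are identified with the measures $(c+rG)\,dx$. The resulting measures are regarded as measures on $\mathbb R_+^2$ that do not charge the coordinate axes. ''Signed Radon measure'' means a locally finite signed measure (difference of two Radon measures). *)

(* Defs.v *)
From HB Require Import structures.
From mathcomp Require Import all_boot all_order all_algebra.
From mathcomp Require Import all_classical all_reals all_analysis.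
From mathcomp Require Import measurable_realfun.

Set Implicit Arguments.
Unset Strict Implicit.
Unset Printing Implicit Defensive.
Import Order.TTheory GRing.Theory Num.Theory numFieldNormedType.Exports.
Local Open Scope classical_set_scope.
Local Open Scope ring_scope.

(* The plane [R * R] carries the topology and the norm; [mplane R] is the same
   type seen with the product Borel sigma-algebra in the display used by
   [lebesgue_measure]. The two are convertible. *)
Notation mplane R := (measurableTypeR R * measurableTypeR R)%type.

Section plane.
Variable R : realType.
Implicit Types (x : R * R) (i j : 'I_2).

Definition Rplus2 : set (R * R) := [set x | 0 <= x.1 /\ 0 <= x.2].

Definition Rpos2 : set (R * R) := [set x | 0 < x.1 /\ 0 < x.2].

Definition coord x i : R := if i == ord0 then x.1 else x.2.

Definition basis i : R * R := ((i == ord0)%:R, (i != ord0)%:R).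

Definition partial i (f : R * R -> R) : R * R -> R := fun x => 'D_(basis i) f x.

Fixpoint is_Ck (k : nat) (f : R * R -> R) : Prop :=
  continuous f /\
  if k is k'.+1 then
    forall i, (forall x, derivable f x (basis i)) /\ is_Ck k' (partial i f)
  else True.

(* C_c^oo((0,oo)^2), extended by 0 to the plane *)
Definition test_function (phi : R * R -> R) : Prop :=
  (forall k, is_Ck k phi) /\
  exists K, [/\ compact K, K `<=` Rpos2 & forall x, ~ K x -> phi x = 0].

(* C^2 up to the boundary: the derivatives of order at most 2 exist in the open
   quadrant and extend continuously to the closed one. *)
Definition extends_to_Rplus2 (h : R * R -> R) : Prop :=
  exists2 k : R * R -> R, {within Rplus2, continuous k} &
    forall x, Rpos2 x -> h x = k x.

Definition is_C2_Rplus2 (f : R * R -> R) : Prop :=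
  {within Rplus2, continuous f} /\
  forall i, [/\ forall x, Rpos2 x -> derivable f x (basis i),
    extends_to_Rplus2 (partial i f) &
    forall j, (forall x, Rpos2 x -> derivable (partial i f) x (basis j)) /\
      extends_to_Rplus2 (partial j (partial i f))].

Definition hessian (f : R * R -> R) x : 'M[R]_2 :=
  \matrix_(i, j) partial i (partial j f) x.

Definition amat (sig : R * R -> 'M[R]_2) x : 'M[R]_2 := sig x *m (sig x)^T.

Definition generator (b : R * R -> 'rV[R]_2) (sig : R * R -> 'M[R]_2)
    (f : R * R -> R) x : R :=
  \sum_i b x 0 i * partial i f x + 2^-1 * \tr (amat sig x *m hessian f x).

Definition locally_lipschitz (V : normedModType R) (f : R * R -> V) : Prop :=
  forall x, Rplus2 x -> exists K : R, exists2 e : R, 0 < e &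
    forall y z, Rplus2 y -> Rplus2 z -> `|y - x| < e -> `|z - x| < e ->
      `|f y - f z| <= K * `|y - z|.

End plane.

Section measures.
Variable R : realType.

Definition leb2 : {measure set (mplane R) -> \bar R} :=
  (@lebesgue_measure R \x @lebesgue_measure R)%E.

(* Borel subsets of [E] whose closure is compact in [E]. *)
Definition bounded_borel (E A : set (mplane R)) : Prop :=
  measurable A /\
  exists K : set (R * R), [/\ compact K, A `<=` K & K `<=` E].

(* [E] is the open or the closed quadrant, so that locally finite, finite on
   compact sets and Radon mean the same for Borel measures. A measure on [E] is
   a measure on the plane that does not charge the complement of [E]. *)
Definition radon_on (E : set (R * R)) (mu : {measure set (mplane R) -> \bar R})
    : Prop :=
  mu (~` E) = 0%E /\
  forall K : set (R * R), compact K -> K `<=` E -> (mu K < +oo)%E.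

Record signed_radon (E : set (R * R)) := SignedRadon {
  sr_pos : {measure set (mplane R) -> \bar R} ;
  sr_neg : {measure set (mplane R) -> \bar R} ;
  sr_pos_radon : radon_on E sr_pos ;
  sr_neg_radon : radon_on E sr_neg }.

(* A difference of two Radon measures may be oo - oo on a large set: its values
   are meaningful on the [bounded_borel E] sets, and they determine it. The two
   measures need not be the Jordan decomposition. *)
Definition sr_val E (mu : signed_radon E) (A : set (mplane R)) : R :=
  fine (sr_pos mu A) - fine (sr_neg mu A).

Definition sr_int E (mu : signed_radon E) (A : set (mplane R))
    (f : R * R -> R) : R :=
  \int[sr_pos mu]_(x in A) f x - \int[sr_neg mu]_(x in A) f x.

Definition weak_gradient (f : R * R -> R) (g : 'I_2 -> R * R -> R) : Prop :=
  forall i,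
  [/\ measurable_fun (Rpos2 (R := R) : set (mplane R)) (g i),
    forall A, bounded_borel (@Rpos2 R) A -> leb2.-integrable A (EFin \o g i) &
    forall phi, test_function phi ->
      \int[leb2]_(x in @Rpos2 R) (f x * partial i phi x) =
      - \int[leb2]_(x in @Rpos2 R) (g i x * phi x)].

Definition hessian_measure (f : R * R -> R)
    (H : 'I_2 -> 'I_2 -> signed_radon (@Rpos2 R)) : Prop :=
  forall i j phi, test_function phi ->
    \int[leb2]_(x in @Rpos2 R) (f x * partial i (partial j phi) x) =
    sr_int (H i j) (@Rpos2 R) phi.

(* [M] is the measure b . grad f dx + 1/2 Tr (a D^2 f (dx)) of the open
   quadrant, regarded as a measure on the closed one that does not charge the
   axes. *)
Definition generator_measure (b : R * R -> 'rV[R]_2)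
    (sig : R * R -> 'M[R]_2) (f : R * R -> R)
    (M : signed_radon (@Rplus2 R)) : Prop :=
  exists g H, [/\ weak_gradient f g, hessian_measure f H,
    forall A, bounded_borel (@Rpos2 R) A ->
      sr_val M A =
        \int[leb2]_(x in A) (\sum_i b x 0 i * g i x) +
        2^-1 * \sum_i \sum_j sr_int (H j i) A (fun x => amat sig x i j) &
    forall A, bounded_borel (@Rplus2 R) A -> A `&` @Rpos2 R = set0 ->
      sr_val M A = 0].

End measures.

Section diagonal.
Variable R : realType.
Variable alpha : R.

Definition maxG (x : R * R) : R := Num.max x.1 (alpha * x.2).

Definition Diag : set (R * R) := [set x | Rplus2 x /\ x.1 = alpha * x.2].

(* unit speed parametrisation of [Diag] by [0, oo[ *)
Definition diag_ray (s : measurableTypeR R) : mplane R :=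
  (s * (alpha / Num.sqrt (1 + alpha ^+ 2)), s * (Num.sqrt (1 + alpha ^+ 2))^-1).

Lemma measurable_diag_ray : measurable_fun setT diag_ray.
Proof. by apply/measurable_fun_pair => //; exact: measurable_funM. Qed.

Definition arc_length (A : set (mplane R)) : \bar R :=
  pushforward (mrestr (@lebesgue_measure R) (measurable_itv `[0, +oo[))
    diag_ray A.

Let arc_length0 : arc_length set0 = 0%E.
Proof. by rewrite /arc_length /pushforward preimage_set0 measure0. Qed.

Let arc_length_ge0 A : (0 <= arc_length A)%E.
Proof. by rewrite /arc_length /pushforward measure_ge0. Qed.

Let arc_length_sigma_additive : semi_sigma_additive arc_length.
Proof.
move=> F mF tF mUF; rewrite /arc_length /pushforward preimage_bigcup.
have mpre B : measurable B -> measurable (diag_ray @^-1` B).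
  by move=> mB; rewrite -[X in measurable X]setTI; exact: measurable_diag_ray.
apply: measure_semi_sigma_additive.
- by move=> n; exact: mpre.
- apply/trivIsetP => /= i j _ _ ij; rewrite -preimage_setI.
  by move/trivIsetP : tF => /(_ _ _ _ _ ij) ->//; rewrite preimage_set0.
- by rewrite -preimage_bigcup; exact: mpre.
Qed.

HB.instance Definition _ := isMeasure.Build _ _ _ arc_length
  arc_length0 arc_length_ge0 arc_length_sigma_additive.

(* the row vector (1, - alpha) *)
Definition diag_normal : 'rV[R]_2 :=
  \row_(j < 2) (if j == ord0 then 1 else - alpha).

Definition Gamma_ac (b : R * R -> 'rV[R]_2) (c : R * R -> R) (r : R)
    (x : R * R) : R :=
  c x + r * maxG x
  - b x 0 ord0 * (if alpha * x.2 < x.1 then 1 else 0)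
  - alpha * b x 0 ord_max * (if x.1 < alpha * x.2 then 1 else 0).

Definition Gamma_diag (sig : R * R -> 'M[R]_2) (x : R * R) : R :=
  - ((diag_normal *m amat sig x *m diag_normal^T) 0 0
     / (2 * Num.sqrt (1 + alpha ^+ 2))).

End diagonal.

Section reflected_sde.
Context (R : realType) (d : measure_display) (Om : measurableType d).
Variable P : probability Om R.

(* Processes are indexed by R; only times t >= 0 are relevant. *)
Implicit Types (W X L : R -> Om -> R * R) (H B I Y : R -> Om -> R).

(* the filtration generated by [W], augmented by the null sets of [P] *)
Definition brownian_filtration W (t : R) : set (set Om) :=
  <<s [set A | exists i s (C : set R), [/\ 0 <= s <= t, measurable C &
                 A = (fun w => coord (W s w) i) @^-1` C]]
      `|` [set A | measurable A /\ P A = 0%E] >>.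

Definition adapted (F : R -> set (set Om)) Y : Prop :=
  forall t, 0 <= t -> forall C : set R, measurable C -> F t (Y t @^-1` C).

Definition brownian_motion W : Prop :=
  [/\ forall t i, 0 <= t -> measurable_fun setT (fun w => coord (W t w) i),
      forall w, W 0 w = (0, 0),
      forall w, {within `[0, +oo[, continuous (fun t => W t w)} &
      forall s t, 0 <= s -> s < t -> forall A, brownian_filtration W s A ->
      forall C1 C2 : set R, measurable C1 -> measurable C2 ->
        P ([set w | C1 ((W t w).1 - (W s w).1)]
           `&` [set w | C2 ((W t w).2 - (W s w).2)] `&` A) =
        (normal_prob 0 (Num.sqrt (t - s)) C1 *
         normal_prob 0 (Num.sqrt (t - s)) C2 * P A)%E].

Definition ito_sum H B (t : R) (n : nat) (w : Om) : R :=
  \sum_(k < n) H (t * k%:R / n%:R) w *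
    (B (t * k.+1%:R / n%:R) w - B (t * k%:R / n%:R) w).

(* For continuous adapted [H] and a Brownian motion [B], the Ito integral is the
   limit in probability of the left-point Riemann sums. *)
Definition is_ito_integral H B I : Prop :=
  forall t, 0 <= t -> measurable_fun setT (I t) /\
    forall e, 0 < e ->
      (fun n => P [set w | e <= `|ito_sum H B t n w - I t w|]) @ \oo --> 0%E.

(* A [cumulative] is nondecreasing, hence so is each L^i on [0, oo[. [L] is
   extended by [L 0] to negative times, so that the Lebesgue-Stieltjes measure
   dL^i is carried by [0, oo[ and has no mass at 0. *)
Definition reflection_term X L : Prop :=
  forall w, L 0 w = (0, 0) /\
  forall i, exists l : cumulative R R,
    (forall t, l t = coord (L (Num.max t 0) w) i) /\
    (\int[lebesgue_stieltjes_measure l]_(s in `[0%R, +oo[)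
       (\1_[set u : R | (0 < coord (X u w) i)%R] s)%:E = 0)%E.

(* (X, L) solves dX = b(X) dt + sig(X) dW + dL with normal reflection in the
   closed quadrant and X_0 = x, and is adapted to the augmented filtration of
   [W]: it is a strong solution. *)
Record strong_solution W (b : R * R -> 'rV[R]_2) (sig : R * R -> 'M[R]_2)
    (x : R * R) X L : Prop := {
  sol_adapted : forall i,
    adapted (brownian_filtration W) (fun t w => coord (X t w) i) /\
    adapted (brownian_filtration W) (fun t w => coord (L t w) i) ;
  sol_continuous : forall w,
    {within `[0, +oo[, continuous (fun t => X t w)} /\
    {within `[0, +oo[, continuous (fun t => L t w)} ;
  sol_Rplus2 : forall t w, 0 <= t -> Rplus2 (X t w) ;
  sol_reflection : reflection_term X L ;
  sol_equation : exists I : 'I_2 -> 'I_2 -> R -> Om -> R,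
    (forall i j, is_ito_integral (fun t w => sig (X t w) i j)
                   (fun t w => coord (W t w) j) (I i j)) /\
    forall i t, 0 <= t -> {ae P, forall w,
      coord (X t w) i = coord x i
        + \int[@lebesgue_measure R]_(s in `[0, t]) b (X s w) 0 i
        + \sum_j I i j t w + coord (L t w) i} }.

Definition unique_strong_solution W b sig x : Prop :=
  (exists X L, strong_solution W b sig x X L) /\
  forall X L X' L', strong_solution W b sig x X L ->
    strong_solution W b sig x X' L' ->
    {ae P, forall w, forall t, 0 <= t -> X t w = X' t w /\ L t w = L' t w}.

Variables (W : R -> Om -> R * R) (b : R * R -> 'rV[R]_2).
Variables (sig : R * R -> 'M[R]_2) (c : R * R -> R) (r : R) (G : R * R -> R).

(* The library norms are max-norms; since the constants K, KPsi are existentially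
   quantified, the Euclidean norms give the same conditions. *)
Definition assumption_A1 : Prop :=
  [/\ [/\ {within @Rplus2 R, continuous b},
          {within @Rplus2 R, continuous sig},
          locally_lipschitz b & locally_lipschitz sig],
      exists2 K : R, 0 < K & forall x, Rplus2 x ->
        `|b x| + `|sig x| <= K * (1 + `|x|),
      forall C : set (R * R), compact C -> C `<=` @Rpos2 R ->
        exists2 l : R, 0 < l & forall x (xi : 'rV[R]_2), C x ->
          l * (xi *m xi^T) 0 0 <= (xi *m amat sig x *m xi^T) 0 0 &
      forall x, Rplus2 x -> unique_strong_solution W b sig x].

(* E_x is the expectation for the (unique) solution started at x. *)
Definition assumption_A2 : Prop :=
  [/\ forall x, Rplus2 x -> 0 <= c x,
      {within @Rplus2 R, continuous c},
      exists (K : R) (p : nat), forall x, Rplus2 x -> c x <= K * (1 + `|x| ^+ p),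
      0 < r &
      forall x, Rplus2 x -> forall X L, strong_solution W b sig x X L ->
        (\int[P]_w \int[@lebesgue_measure R]_(s in `[0%R, +oo[)
           (expR (- (r * s)) * c (X s w))%:E < +oo)%E /\
        (\int[P]_w ereal_sup [set (expR (- (r * t)) * G (X t w))%:E
                             | t in `[0%R, +oo[] < +oo)%E].

Definition assumption_A3 : Prop :=
  exists (Psi : R * R -> R) (KPsi lPsi m : R),
  [/\ is_C2_Rplus2 Psi,
      [/\ 0 < KPsi, 0 < lPsi, 1 <= m & lPsi < r],
      forall x, Rplus2 x -> 1 + `|x| `^ m <= KPsi * Psi x,
      forall x, Rplus2 x -> G x + c x <= KPsi * Psi x &
      forall x, Rpos2 x -> generator b sig Psi x <= lPsi * Psi x + KPsi].

Definition standing_assumptions : Prop :=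
  [/\ assumption_A1, assumption_A2 & assumption_A3].

End reflected_sde.

(* Main.v *)
Require Import Defs.
From HB Require Import structures.
From mathcomp Require Import all_boot all_order all_algebra.
From mathcomp Require Import all_classical all_reals all_analysis.
From mathcomp Require Import measurable_realfun ring lra.
Import Order.TTheory GRing.Theory Num.Theory numFieldNormedType.Exports.
Set Implicit Arguments.
Unset Strict Implicit.
Unset Printing Implicit Defensive.
Local Open Scope classical_set_scope.
Local Open Scope ring_scope.

(** Write [G = max (x1, alpha x2)] and [n = (1, - alpha)]. For a test function
    [phi], Fubini's theorem and one-dimensional integration by parts on the
    lines parallel to the axes show that the weak gradient of [G] is
    [(1_{x1 > alpha x2}, alpha 1_{x1 < alpha x2})], and once more that
    [D^2 G] tested against [phi] is [n_i n_j \int phi (alpha t, t) dt], that is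
    [n_i n_j / sqrt (1 + alpha^2)] times arc length on the diagonal. This gives
    one measure [LG] with the announced decomposition. Any other pair of weak
    gradient and Hessian measure defines the same [LG] on bounded sets:
    indicators of open boxes of the open quadrant are bounded pointwise limits
    of test functions, and boxes are a pi-system generating the Borel sets. *)

(** * Borel sets of the plane *)

(** The weak gradient and the Hessian in [generator_measure] are existentially quantified, and the
    conclusion concerns every admissible [LG], so an explicit representative alone does not suffice.
    Two obstacles shape the uniqueness argument. A signed measure is a pair whose difference may be
    [oo - oo], so equalities of signed measures are rewritten as equalities between sums of positive
    measures, which make sense on all Borel sets. Test functions only see compact parts of the open
    quadrant, whereas the bounded sets of the conclusion may reach the axes; the gap is closed by
    exhausting the open quadrant with boxes, and by the clause of [generator_measure] on sets
    outside it, which holds for the explicit representative because neither Lebesgue measure nor arc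
    length charges the axes. *)

Section plane_measurability.
Variable R : realType.
Implicit Types (x : R * R).

(** Second countability: an open set is a countable union of open rectangles with rational
    endpoints. This is the bridge from the topology of [R * R] to the product sigma-algebra of
    [mplane R]. *)
Lemma open_plane_measurable (U : set (R * R)) :
  open U -> measurable (U : set (mplane R)).
Proof.
move=> oU.
pose B (p : rat * rat * rat * rat) : set (mplane R) :=
  `]ratr p.1.1.1, ratr p.1.1.2[%classic `*` `]ratr p.1.2, ratr p.2[%classic.
have -> : U = \bigcup_(p in [set p | B p `<=` U]) B p.
  apply/seteqP; split=> [x Ux|x [p pU Bp]]; last exact: pU.
  have /nbhs_ballP[e /= e0 xeU] : nbhs x U by exact: open_nbhs_nbhs.
  have lt1 (t : R) : t - e < t by rewrite ltrBlDr ltrDl.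
  have lt2 (t : R) : t < t + e by rewrite ltrDl.
  have [p1] := rat_in_itvoo (lt1 x.1); have [p2] := rat_in_itvoo (lt2 x.1).
  have [q1] := rat_in_itvoo (lt1 x.2); have [q2] := rat_in_itvoo (lt2 x.2).
  rewrite !in_itv/= => /andP[q2l q2r] /andP[q1l q1r] /andP[p2l p2r] /andP[p1l p1r].
  exists (p1, p2, q1, q2); last by split; rewrite /= in_itv/=; apply/andP.
  move=> y [/=]; rewrite !in_itv/= => /andP[y1 y2] /andP[y3 y4]; apply: xeU.
  split; rewrite /ball/= ltr_norml; lra.
rewrite bigcup_mkcond; apply: countable_bigcupT_measurable => [|p].
  exact: countableP.
by case: ifP => _; [exact: measurableX|exact: measurable0].
Qed.

Lemma closed_plane_measurable (C : set (R * R)) :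
  closed C -> measurable (C : set (mplane R)).
Proof.
move=> cC; have := open_plane_measurable (closed_openC cC).
by move=> /(@measurableC _ (mplane R)); rewrite setCK.
Qed.

Lemma compact_plane_closed (K : set (R * R)) : compact K -> closed K.
Proof. by apply: compact_closed; exact: norm_hausdorff. Qed.

Lemma compact_plane_measurable (K : set (R * R)) :
  compact K -> measurable (K : set (mplane R)).
Proof. by move=> /compact_plane_closed/closed_plane_measurable.
Qed.

Lemma continuous_within_measurable (C : set (R * R)) (f : R * R -> R) :
  closed C -> {within C, continuous f} ->
  measurable_fun (C : set (mplane R)) f.
Proof.
move=> cC cf.
apply: (measurability _ (RGenOpens.measurableE R)) => _ [_ [a [b ->] <-]].
have /open_subspaceP[V oV VC] : open (f @^-1` `]a, b[%classic : set (subspace C)).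
  by move/continuousP : cf; apply; exact: interval_open.
rewrite setIC -VC.
by apply: measurableI; [exact: open_plane_measurable|exact: closed_plane_measurable].
Qed.

Lemma continuous_plane_measurable (f : R * R -> R) :
  continuous f -> measurable_fun (setT : set (mplane R)) f.
Proof.
move=> cf; apply: continuous_within_measurable; first exact: closedT.
by apply: continuous_subspaceT.
Qed.

Lemma closed_Rplus2 : closed (@Rplus2 R).
Proof.
rewrite (_ : Rplus2 (R:=R) = fst @^-1` [set x | 0 <= x] `&` snd @^-1` [set x | 0 <= x]) //.
apply: closedI; apply: closed_comp; do ?exact: closed_ge.
- by move=> x _; exact: cvg_fst.
- by move=> x _; exact: cvg_snd.
Qed.

Lemma open_Rpos2 : open (@Rpos2 R).
Proof.
rewrite (_ : Rpos2 (R:=R) = fst @^-1` [set x | 0 < x] `&` snd @^-1` [set x | 0 < x]) //.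
apply: openI; apply: open_comp; do ?exact: open_gt.
- by move=> x _; exact: cvg_fst.
- by move=> x _; exact: cvg_snd.
Qed.

Lemma measurable_Rplus2 : measurable (@Rplus2 R : set (mplane R)).
Proof. by apply: closed_plane_measurable; exact: closed_Rplus2. Qed.

Lemma measurable_Rpos2 : measurable (@Rpos2 R : set (mplane R)).
Proof. by apply: open_plane_measurable; exact: open_Rpos2. Qed.

Lemma sub_Rpos2_Rplus2 : @Rpos2 R `<=` @Rplus2 R.
Proof. by move=> x [/ltW ? /ltW ?]. Qed.

Lemma compact_plane_box (K : set (R * R)) : compact K ->
  exists2 M : R, 0 < M & forall x, K x -> `|x.1| < M /\ `|x.2| < M.
Proof.
move=> /compact_bounded/= [M [_ hM]].
exists (`|M| + 2); first by rewrite ltr_wpDl.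
move=> x /hM -/(_ (`|M| + 1)); rewrite (le_lt_trans (ler_norm M)) ?ltrDl//.
move=> /(_ isT) /=; rewrite prod_normE ge_max => /andP[h1 h2].
by split; [move: h1|move: h2] => /le_lt_trans; apply; rewrite ltrD2l ltr1n.
Qed.

Lemma bounded_within_compact (K : set (R * R)) (f : R * R -> R) :
  compact K -> {within K, continuous f} -> exists M : R, forall x, K x -> `|f x| <= M.
Proof.
move=> cK cf.
have /compact_bounded[M [_ hM]] : compact (f @` K).
  exact: (@continuous_compact _ _ f K).
exists (M + 1) => x Kx; apply: (hM (M + 1)); first by rewrite ltrDl.
by exists x.
Qed.

Lemma bounded_plane_integrable (m : {measure set (mplane R) -> \bar R})
    (A K : set (mplane R)) (f : mplane R -> R) (M : R) :
  measurable A -> measurable K -> A `<=` K -> (m K < +oo)%E ->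
  measurable_fun A f -> (forall x, A x -> `|f x| <= M) ->
  m.-integrable A (EFin \o f).
Proof.
move=> mA mK AK mKoo mf fM; apply: measurable_bounded_integrable => //.
  by apply: le_lt_trans mKoo; apply: le_measure => //; rewrite inE.
exists M; split; first exact: num_real.
by move=> y My x Ax /=; rewrite (le_trans (fM _ Ax))// ltW.
Qed.

Lemma compact_plane_integrable (m : {measure set (mplane R) -> \bar R})
    (A : set (mplane R)) (K : set (R * R)) (f : R * R -> R) :
  measurable A -> compact K -> A `<=` K -> (m K < +oo)%E ->
  {within K, continuous f} -> m.-integrable A (EFin \o f).
Proof.
move=> mA cK AK mKoo cf; have [M fM] := bounded_within_compact cK cf.
apply: (@bounded_plane_integrable m A K f M) => //.
- exact: compact_plane_measurable.
- apply: (@measurable_funS _ _ _ _ (K : set (mplane R))) => //.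
    exact: compact_plane_measurable.
  by apply: continuous_within_measurable => //; exact: compact_plane_closed.
- by move=> x /AK; exact: fM.
Qed.

End plane_measurability.

(** * Test functions *)

Section flat_functions.
Variable R : realType.
Implicit Types (P : {poly R}) (t : R).

(* These functions are closed under differentiation, which makes [flat 1], that
   is [exp (- 1 / t)] extended by 0 to [t <= 0], smooth. *)
Definition flat P t : R := if 0 < t then P.[t^-1] * expR (- t^-1) else 0.

(** By the product and chain rules, [P(1/t) exp(-1/t)] has derivative
    [t^-2 (P - P')(1/t) exp(-1/t)]; the factor [t^-2] becomes ['X^2]. *)
Definition flat_deriv P : {poly R} := 'X^2 * (P - P^`()).

Lemma flat_le0 P t : t <= 0 -> flat P t = 0.
Proof. by rewrite /flat leNgt => /negbTE ->. Qed.

Lemma expR_powN_le (n : nat) (y : R) : 0 <= y -> y ^+ n.+1 * expR (- y) <= n.+1`!%:R.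
Proof.
move=> y0; have := expR_ge1Dxn n y0 => h.
rewrite expRN ler_pdivrMr ?expR_gt0// -ler_pdivrMl ?ltr0n ?fact_gt0// mulrC.
by apply: le_trans h; rewrite lerDr.
Qed.

(** With [y = 1/t], each monomial satisfies [y^(i+2) exp(-y) <= (i+2)!]. The two spare powers of [y]
    give the factor [t^2], one power more than the difference quotient at 0 consumes. *)
Lemma flat_bound P : exists C : R, forall t, `|flat P t| <= C * t ^+ 2.
Proof.
exists (\sum_(i < size P) `|P`_i| * (i.+2)`!%:R) => t.
have [t0|t0] := leP t 0.
  rewrite flat_le0// normr0 mulr_ge0 ?sqr_ge0//.
  by apply: sumr_ge0 => i _; rewrite mulr_ge0.
rewrite /flat t0 horner_coef normrM (gtr0_norm (expR_gt0 _)).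
apply: (@le_trans _ _ ((\sum_(i < size P) `|P`_i| * t^-1 ^+ i) * expR (- t^-1))).
  rewrite ler_wpM2r ?expR_ge0// (le_trans (ler_norm_sum _ _ _))// ler_sum// => i _.
  by rewrite normrM normrX (@gtr0_norm _ t^-1)// invr_gt0.
rewrite !mulr_suml ler_sum// => i _.
rewrite -!mulrA ler_wpM2l// -ler_pdivrMr ?exprn_gt0// mulrAC -exprVn -exprD addn2.
by rewrite expR_powN_le// invr_ge0 ltW.
Qed.

Lemma is_derive_flat P t : is_derive t 1 (flat P) (flat (flat_deriv P) t).
Proof.
have [t0|t0|->] := ltgtP t 0.
- rewrite flat_le0 ?ltW//.
  have := is_derive_cst (0 : R) t 1; apply: near_eq_is_derive.
  near=> s; rewrite flat_le0//; apply/ltW.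
  by near: s; exact: lt_nbhsl.
- pose f s : R := P.[s^-1] * expR (- s^-1).
  apply: (@near_eq_is_derive _ _ _ f).
    near=> s; rewrite /flat (_ : 0 < s)//.
    by near: s; exact: lt_nbhsr.
  have dV : is_derive t 1 (fun s : R => s^-1) (- t ^- 2).
    by have := @is_deriveV R id t 1 1; rewrite /= scaler1 gt_eqF//; apply.
  have dNV : is_derive t 1 (fun s : R => - s^-1) (t ^- 2).
    by rewrite -[X in is_derive _ _ _ X]opprK; apply: is_deriveN.
  have dP := @is_derive1_comp R (horner P) (fun s => s^-1) t _ _ (is_derive_poly _ _) dV.
  have dE := @is_derive1_comp R expR (fun s => - s^-1) t _ _ (is_derive_expR _) dNV.
  apply: (is_derive_eq (is_deriveM dP dE : is_derive t 1 f _)).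
  rewrite /flat t0 /flat_deriv !hornerE /=.
  have sE (a b : R) : a *: (b : R^o) = a * b by [].
  by rewrite !sE -exprVn; ring.
- rewrite flat_le0//.
  have [C hC] := flat_bound P.
  have h : (fun h => h^-1 *: ((flat P \o shift 0) (h *: 1) - flat P 0)) @ 0^' --> (0 : R).
    apply/cvgr0Pnorm_le => e e0; near=> s.
    have s0 : s != 0 by near: s; exact: nbhs_dnbhs_neq.
    rewrite /= addr0 (flat_le0 P (lexx 0)) subr0 /GRing.scale/= mulr1 normrM normfV.
    rewrite ler_pdivrMl ?normr_gt0// (le_trans (hC _))//.
    (* The quotient is at most [C |s|]; [|C| + 1] is a positive upper bound for [C] whatever its
       sign. *)
    have : `|s| <= e / (`|C| + 1).
      near: s; apply: dnbhs0_le; rewrite divr_gt0// ltr_wpDl//.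
    rewrite ler_pdivlMr ?ltr_wpDl// => hs.
    rewrite -real_normK ?num_real// expr2 mulrA [leLHS]mulrC.
    rewrite ler_wpM2l// (le_trans _ hs)// mulrC ler_wpM2l//.
    by rewrite (le_trans (ler_norm _))// lerDl.
  by apply: DeriveDef; [exact: cvgP h|exact: cvg_lim h].
Unshelve. all: by end_near. Qed.

Lemma continuous_flat P : continuous (flat P).
Proof.
move=> t; apply/differentiable_continuous/derivable1_diffP.
by have [] := is_derive_flat P t.
Qed.

Lemma flat1_ge0 t : 0 <= flat 1 t.
Proof. by rewrite /flat; case: ifP => // _; rewrite hornerE mul1r expR_ge0. Qed.

Lemma flat1_le1 t : flat 1 t <= 1.
Proof.
rewrite /flat; case: ifP => // t0; rewrite hornerE mul1r.
by rewrite -expR0 ler_expR oppr_le0 invr_ge0 ltW.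
Qed.

Lemma flat1_cvg t : flat 1 (n.+1%:R * t) @[n --> \oo] --> ((0 < t)%R%:R : R).
Proof.
have [t0|t0] := ltP 0 t; last first.
  apply: cvg_near_cst; apply: nearW => n.
  by rewrite flat_le0// mulr_ge0_le0.
rewrite [X in X @ \oo](_ : _ = expR \o (fun n => - (n.+1%:R^-1 * t^-1))); last first.
  apply/funext => n /=.
  by rewrite /flat mulr_gt0 ?ltr0Sn// hornerE mul1r invfM.
rewrite (_ : true%:R = expR (- (0 * t^-1))); last by rewrite mul0r oppr0 expR0.
apply: continuous_cvg; first exact: continuous_expR.
by apply: cvgN; apply: cvgMr_tmp; exact: cvg_harmonic.
Qed.

End flat_functions.

Section differentiability_classes.
Variable R : realType.
Implicit Types (f g phi : R * R -> R) (x v : R * R).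

(** The two difference quotients are the same function of [h], so directional derivatives can be
    computed by one-variable calculus. *)
Lemma slice_is_derive f x v (d : R) :
  is_derive (0 : R) 1 (fun h => f (h *: v + x)) d -> is_derive x v f d.
Proof.
have E : (fun h => h^-1 *: (((fun h => f (h *: v + x)) \o shift 0) (h *: (1 : R)) -
      f (0 *: v + x))) =
    (fun h : R => h^-1 *: ((f \o shift x) (h *: v) - f x)) :> (R -> R).
  by apply/funext => h /=; rewrite addr0 [h%:A]mulr1 scale0r add0r.
by case; rewrite /derivable /derive E => ? ?; apply: DeriveDef.
Qed.

Lemma partial0_is_derive phi (s t : R) : derivable phi (s, t) (@Defs.basis R ord0) ->
  is_derive s 1 (fun s => phi (s, t)) (partial ord0 phi (s, t)).
Proof.
have E : (fun h : R => h^-1 *: (((fun s => phi (s, t)) \o shift s) (h *: 1) - phi (s, t))) =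
    (fun h : R => h^-1 *: ((phi \o shift (s, t)) (h *: @Defs.basis R ord0) -
      phi (s, t))) :> (R -> R).
  apply/funext => h /=; congr (_ *: (phi _ - _)).
  by rewrite /basis/=; congr pair; rewrite /= -[h *: _]/(h * 0) mulr0 add0r.
by move=> d; apply: DeriveDef; rewrite /derivable /derive E.
Qed.

Lemma partial1_is_derive phi (s t : R) : derivable phi (s, t) (@Defs.basis R ord_max) ->
  is_derive t 1 (fun t => phi (s, t)) (partial ord_max phi (s, t)).
Proof.
have E : (fun h : R => h^-1 *: (((fun t => phi (s, t)) \o shift t) (h *: 1) - phi (s, t))) =
    (fun h : R => h^-1 *: ((phi \o shift (s, t)) (h *: @Defs.basis R ord_max) -
      phi (s, t))) :> (R -> R).
  apply/funext => h /=; congr (_ *: (phi _ - _)).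
  by rewrite /basis/=; congr pair; rewrite /= -[h *: _]/(h * 0) mulr0 add0r.
by move=> d; apply: DeriveDef; rewrite /derivable /derive E.
Qed.

Lemma is_Ck_continuous k f : is_Ck k f -> continuous f.
Proof. by case: k => [|k] []. Qed.

Lemma is_Ck_partial k i f : is_Ck k.+1 f -> is_Ck k (partial i f).
Proof. by case=> _ /(_ i)[]. Qed.

Lemma is_Ck_derivable k i f x : is_Ck k.+1 f -> derivable f x (@Defs.basis R i).
Proof. by case=> _ /(_ i)[]. Qed.

Lemma is_CkW k f : is_Ck k.+1 f -> is_Ck k f.
Proof.
elim: k f => [|k IH] f; first by case.
case=> cf df; split => // i; have [dfi Cfi] := df i; split => //.
exact: IH.
Qed.

Lemma is_CkD k f g : is_Ck k f -> is_Ck k g -> is_Ck k (fun x => f x + g x).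
Proof.
elim: k f g => [|k IH] f g Cf Cg; split.
- by move=> x; apply: cvgD; [exact: (is_Ck_continuous Cf)|exact: (is_Ck_continuous Cg)].
- by [].
- by move=> x; apply: cvgD; [exact: (is_Ck_continuous Cf)|exact: (is_Ck_continuous Cg)].
- move=> i; split.
    by move=> x; apply: derivableD; [exact: is_Ck_derivable Cf|exact: is_Ck_derivable Cg].
  rewrite (_ : partial _ _ = fun x => partial i f x + partial i g x).
    by apply: IH; exact: is_Ck_partial.
  apply/funext => x.
  by apply: deriveD; [exact: is_Ck_derivable Cf|exact: is_Ck_derivable Cg].
Qed.

Lemma is_CkM k f g : is_Ck k f -> is_Ck k g -> is_Ck k (fun x => f x * g x).
Proof.
elim: k f g => [|k IH] f g Cf Cg; split.
- by move=> x; apply: cvgM; [exact: (is_Ck_continuous Cf)|exact: (is_Ck_continuous Cg)].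
- by [].
- by move=> x; apply: cvgM; [exact: (is_Ck_continuous Cf)|exact: (is_Ck_continuous Cg)].
- move=> i; split.
    by move=> x; apply: derivableM; [exact: is_Ck_derivable Cf|exact: is_Ck_derivable Cg].
  rewrite (_ : partial _ _ = fun x => f x * partial i g x + g x * partial i f x).
    by apply: is_CkD; apply: IH; by [exact: is_CkW|exact: is_Ck_partial].
  apply/funext => x.
  by apply: deriveM; [exact: is_Ck_derivable Cf|exact: is_Ck_derivable Cg].
Qed.

Lemma continuous_flat_affine (c p q w : R) (P : {poly R}) :
  continuous (fun x : R * R => c * flat P (p * x.1 + q * x.2 + w)).
Proof.
move=> x; apply: cvgMl_tmp; apply: continuous_cvg; first exact: continuous_flat.
apply: cvgD; last exact: cvg_cst.
by apply: cvgD; apply: cvgMl_tmp; [exact: cvg_fst|exact: cvg_snd].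
Qed.

(** This family is stable under partial derivatives: each one multiplies [c] by [p] or [q] and
    replaces [P] by [flat_deriv P]. Hence the induction on [k] keeps [c] and [P] general. *)
Lemma is_Ck_flat k (c p q w : R) (P : {poly R}) :
  is_Ck k (fun x => c * flat P (p * x.1 + q * x.2 + w)).
Proof.
elim: k c P => [|k IH] c P; have cont := @continuous_flat_affine c p q w P.
  by split.
split => // i.
pose e := p * (@Defs.basis R i).1 + q * (@Defs.basis R i).2.
have D x : is_derive x (@Defs.basis R i) (fun x => c * flat P (p * x.1 + q * x.2 + w))
    (c * e * flat (flat_deriv P) (p * x.1 + q * x.2 + w)).
  apply: slice_is_derive.
  have dl : is_derive (0 : R) 1 (fun h => e * h + (p * x.1 + q * x.2 + w)) e.
    apply: is_derive_eq; by rewrite addr0 [e *: 1]mulr1.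
  have := @is_derive1_comp R (flat P) _ 0 _ _ (is_derive_flat P _) dl.
  move=> /(is_deriveZ c); rewrite mulr0 add0r.
  rewrite [X in is_derive _ _ X _ -> _](_ : _ = 
    (fun h : R => c * flat P (p * (h *: @Defs.basis R i + x).1 +
      q * (h *: @Defs.basis R i + x).2 + w))).
    move=> H; apply: (is_derive_eq H); rewrite -[LHS]/(c * (_ * _)); ring.
  apply/funext => h /=; congr (_ * flat P _).
  have sE (a b : R) : a *: (b : R^o) = a * b by [].
  by rewrite !sE /e /=; ring.
split; first by move=> x; have [] := D x.
rewrite (_ : partial _ _ = (fun x => c * e * flat (flat_deriv P) (p * x.1 + q * x.2 + w))).
  exact: IH.
by apply/funext => x; have [] := D x.
Qed.

Lemma partial_eq0 (K : set (R * R)) i phi x : compact K ->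
  (forall y, ~ K y -> phi y = 0) -> ~ K x -> partial i phi x = 0.
Proof.
move=> cK phi0 nKx; rewrite /partial.
have dx : is_derive x (Defs.basis R i) phi 0.
  have := is_derive_cst (0 : R) x (Defs.basis R i); apply: near_eq_is_derive.
  have oK : open (~` K) by apply: closed_openC; exact: compact_plane_closed.
  have : nbhs x (~` K) by exact: open_nbhs_nbhs.
  by apply: filterS => y nKy; rewrite phi0.
by have [] := dx.
Qed.

Lemma partial_test_function i phi : test_function phi -> test_function (partial i phi).
Proof.
move=> [Cphi [K [cK KP phi0]]]; split; first by move=> k; exact: is_Ck_partial.
by exists K; split => // x; exact: partial_eq0.
Qed.

Definition box (a b c d : R) : set (R * R) := `]a, b[ `*` `]c, d[.

(* Since [flat 1 (n t)] tends to 1 for [t > 0] and vanishes for [t <= 0], these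
   test functions tend to the indicator function of the box: no mollification
   is needed. *)
Definition box_bump (a b c d : R) (n : nat) x : R :=
  (flat 1 (n.+1%:R * (x.1 - a)) * flat 1 (n.+1%:R * (b - x.1))) *
  (flat 1 (n.+1%:R * (x.2 - c)) * flat 1 (n.+1%:R * (d - x.2))).

Lemma box_bump0 a b c d n x : ~ box a b c d x -> box_bump a b c d n x = 0.
Proof.
move=> nbx; apply/eqP; apply: contra_notT nbx => h.
suff H (s t : R) : flat 1 (n.+1%:R * (s - t)) != 0 -> t < s.
  move: h; rewrite /box_bump !mulf_eq0 !negb_or => /andP[/andP[h1 h2] /andP[h3 h4]].
  by split; rewrite /= in_itv/= !H.
apply: contraNT; rewrite -leNgt => st; apply/eqP/flat_le0.
by rewrite mulr_ge0_le0// subr_le0.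
Qed.

Lemma box_bump_ge0 a b c d n x : 0 <= box_bump a b c d n x.
Proof. by rewrite /box_bump !mulr_ge0// flat1_ge0. Qed.

Lemma box_bump_le1 a b c d n x : box_bump a b c d n x <= 1.
Proof.
by rewrite /box_bump !mulr_ile1// ?mulr_ge0// ?flat1_ge0// flat1_le1.
Qed.

Lemma box_bump_cvg a b c d x :
  box_bump a b c d n x @[n --> \oo] --> (\1_(box a b c d) x : R).
Proof.
have -> : \1_(box a b c d) x = (a < x.1)%R%:R * (x.1 < b)%R%:R *
    ((c < x.2)%R%:R * (x.2 < d)%R%:R) :> R.
  rewrite indicE; have [|] := boolP (x \in box a b c d).
    rewrite inE => -[/=]; rewrite !in_itv/= => /andP[-> ->] /andP[-> ->].
    by rewrite !mulr1.
  move=> /negP h; apply/esym/eqP; apply: contra_notT h.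
  rewrite !mulf_eq0 !negb_or !pnatr_eq0 !eqb0 !negbK => /andP[/andP[h1 h2] /andP[h3 h4]].
  by rewrite inE; split; rewrite /= in_itv/=; apply/andP.
rewrite -(subr_gt0 a) -(subr_gt0 x.1) -(subr_gt0 c) -(subr_gt0 x.2).
by apply: cvgM; apply: cvgM; exact: flat1_cvg.
Qed.

Lemma box_compact (a b c d : R) : compact (`[a, b] `*` `[c, d] : set (R * R)).
Proof. by apply: compact_setX; exact: segment_compact. Qed.

(** The support lies in the closed box, and positivity of the lower left corner alone keeps that box
    inside the open quadrant; degenerate boxes are harmless. *)
Lemma box_bump_test a b c d n : 0 < a -> 0 < c -> test_function (box_bump a b c d n).
Proof.
move=> a0 c0; split.
  move=> k; apply: is_CkM; apply: is_CkM.
  - have := is_Ck_flat k 1 n.+1%:R 0 (- n.+1%:R * a) 1.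
    by congr is_Ck; apply/funext => x; rewrite mul1r; congr flat; ring.
  - have := is_Ck_flat k 1 (- n.+1%:R) 0 (n.+1%:R * b) 1.
    by congr is_Ck; apply/funext => x; rewrite mul1r; congr flat; ring.
  - have := is_Ck_flat k 1 0 n.+1%:R (- n.+1%:R * c) 1.
    by congr is_Ck; apply/funext => x; rewrite mul1r; congr flat; ring.
  - have := is_Ck_flat k 1 0 (- n.+1%:R) (n.+1%:R * d) 1.
    by congr is_Ck; apply/funext => x; rewrite mul1r; congr flat; ring.
exists (`[a, b] `*` `[c, d]); split; first exact: box_compact.
  move=> x [/=]; rewrite !in_itv/= => /andP[ax _] /andP[cx _].
  by split; [exact: lt_le_trans ax|exact: lt_le_trans cx].
move=> x h; apply: box_bump0; apply: contra_not h => -[/=].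
rewrite !in_itv/= => /andP[h1 h2] /andP[h3 h4].
by rewrite !ltW.
Qed.

End differentiability_classes.

(** * Measures determined by test functions *)

Section density_measure.
Context d (T : measurableType d) (R : realType).
Variables (m : {measure set T -> \bar R}) (D : set T) (h : T -> R).
Hypotheses (mD : measurable D) (mh : measurable_fun D h).

(** The measure [h^+ dm] carried by [D]. The two hypotheses are arguments of the term so that its
    measure structure can be inferred from it. Applied to [- h] it gives [h^- dm]. *)
Definition pos_density of measurable D & measurable_fun D h :=
  fun A => (\int[m]_(x in A `&` D) (Num.max (h x) 0)%:E)%E.

Local Notation mu := (pos_density mD mh).

Let mu0 : mu set0 = 0%E.
Proof. by rewrite /pos_density set0I integral_set0. Qed.

Let mu_ge0 A : (0 <= mu A)%E.
Proof. by apply: integral_ge0 => x _; rewrite lee_fin le_max lexx orbT. Qed.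

Let mu_additive : semi_sigma_additive mu.
Proof.
move=> F mF tF mUF; rewrite /pos_density setI_bigcupl ge0_integral_bigcup.
- by apply: is_cvg_ereal_nneg_natsum_cond => n _ _; exact: mu_ge0.
- by move=> i; exact: measurableI.
- apply/measurable_EFinP; apply: measurable_maxr; last exact: measurable_cst.
  apply: measurable_funS mh => //.
  by move=> x [n _ []].
- by move=> x _; rewrite lee_fin le_max lexx orbT.
- apply/trivIsetP => i j _ _ ij; rewrite setIACA setIid.
  by move/trivIsetP : tF => /(_ i j I I ij) ->; rewrite set0I.
Qed.

HB.instance Definition _ := isMeasure.Build _ _ _ mu mu0 mu_ge0 mu_additive.

End density_measure.

Section density_theory.
Context d (T : measurableType d) (R : realType).
Variables (m : {measure set T -> \bar R}) (D : set T) (h : T -> R).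
Hypotheses (mD : measurable D) (mh : measurable_fun D h).

Lemma measurable_oppD : measurable_fun D (fun x => - h x).
Proof. exact: measurableT_comp. Qed.

Lemma pos_density_lty A : measurable A ->
  m.-integrable (A `&` D) (EFin \o h) -> (pos_density m mD mh A < +oo)%E.
Proof.
move=> mA ih; rewrite /pos_density.
have mAD := measurableI _ _ mA mD.
have [mh' +] := integrableP _ _ _ ih; apply: le_lt_trans.
apply: ge0_le_integral => //.
- by move=> x _; rewrite lee_fin le_max lexx orbT.
- apply/measurable_EFinP; apply: measurable_maxr; last exact: measurable_cst.
  exact/measurable_EFinP.
- by apply: measurableT_comp.
- move=> x _ /=; rewrite lee_fin ge_max normr_ge0 andbT; exact: ler_norm.
Qed.

Lemma pos_densityB A (mhN : measurable_fun D (fun x => - h x)) : measurable A -> A `<=` D ->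
  m.-integrable A (EFin \o h) ->
  fine (pos_density m mD mh A) - fine (pos_density m mD mhN A) =
  \int[m]_(x in A) h x.
Proof.
move=> mA AD ih; rewrite /pos_density setIidl//.
have mhA : measurable_fun A h by exact: measurable_funS mh.
have ip : m.-integrable A (EFin \o (fun x => Num.max (h x) 0)).
  apply: le_integrable ih => //.
  - by apply/measurable_EFinP; apply: measurable_maxr => //; exact: measurable_cst.
  - move=> x Ax /=; rewrite lee_fin ger0_norm ?le_max ?lexx ?orbT//.
    by rewrite ge_max normr_ge0 andbT; exact: ler_norm.
have iN : m.-integrable A (EFin \o (fun x => Num.max (- h x) 0)).
  apply: le_integrable ih => //.
  - apply/measurable_EFinP; apply: measurable_maxr => //.
    exact: measurableT_comp.
  - move=> x Ax /=; rewrite lee_fin ger0_norm ?le_max ?lexx ?orbT//.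
    by rewrite ge_max normr_ge0 andbT -normrN; exact: ler_norm.
rewrite -[LHS]/(\int[m]_(x in A) Num.max (h x) 0 - \int[m]_(x in A) Num.max (- h x) 0).
rewrite -RintegralB//; apply: eq_Rintegral => x _.
by rewrite !maxEle; case: ifPn => ?; case: ifPn => ?; lra.
Qed.

Lemma pos_density_eq0 A : measurable A -> m (A `&` D) = 0%E ->
  pos_density m mD mh A = 0%E.
Proof.
move=> mA mAD0; rewrite /pos_density.
have mAD := measurableI _ _ mA mD.
apply: null_set_integral => //.
apply/measurable_EFinP; apply: measurable_maxr; last exact: measurable_cst.
by apply: measurable_funS mh => //; exact: subIsetr.
Qed.

End density_theory.

Lemma Rintegral_support d (T : measurableType d) (R : realType)
    (m : {measure set T -> \bar R}) (D E : set T) (f : T -> R) :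
  E `<=` D -> (forall x, D x -> ~ E x -> f x = 0) ->
  \int[m]_(x in D) f x = \int[m]_(x in E) f x.
Proof.
move=> ED f0; rewrite Rintegral_mkcond [RHS]Rintegral_mkcond.
congr (Rintegral m setT _); apply/funext => x; rewrite !patchE.
have [xD|xD] := boolP (x \in D); have [xE|xE] := boolP (x \in E) => //.
  by rewrite f0//; [rewrite inE in xD|move=> xE'; rewrite mem_set in xE].
by rewrite inE in xE; rewrite mem_set// in xD; exact: ED.
Qed.

(** * Boxes as a pi-system and as limits of test functions *)

Section boxes.
Variable R : realType.
Implicit Types (a b c d : R).

Definition open_boxes : set (set (mplane R)) :=
  [set B | exists a b c d, B = box a b c d].

Lemma measurable_box a b c d : measurable (box a b c d : set (mplane R)).
Proof. exact: measurableX. Qed.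

Lemma box_sub a b c d : box a b c d `<=` `[a, b] `*` `[c, d].
Proof.
by move=> x [/=]; rewrite !in_itv/= => /andP[h1 h2] /andP[h3 h4]; rewrite !ltW.
Qed.

Lemma cbox_Rpos2 a b c d : 0 < a -> 0 < c -> `[a, b] `*` `[c, d] `<=` @Rpos2 R.
Proof.
move=> a0 c0 x [/=]; rewrite !in_itv/= => /andP[h1 h2] /andP[h3 h4].
by split; [exact: lt_le_trans h1|exact: lt_le_trans h3].
Qed.

Lemma boxI a b c d a' b' c' d' : box a b c d `&` box a' b' c' d' =
  box (Num.max a a') (Num.min b b') (Num.max c c') (Num.min d d').
Proof.
apply/seteqP; split => x; rewrite /box/=.
  move=> [] [] + + []; rewrite !in_itv/= !gt_max !lt_min.
  by move=> /andP[-> ->] /andP[-> ->] /andP[-> ->] /andP[-> ->].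
move=> []; rewrite !in_itv/= !gt_max !lt_min.
by move=> /andP[/andP[-> ->] /andP[-> ->]] /andP[/andP[-> ->] /andP[-> ->]].
Qed.

Lemma setI_closed_boxes : setI_closed open_boxes.
Proof.
move=> _ _ [a [b [c [d ->]]]] [a' [b' [c' [d' ->]]]].
by rewrite boxI; do 4 eexists.
Qed.

(** Both coordinates are measurable for the sigma-algebra generated by the boxes, since a strip over
    []a, b[] is the union of its truncations by []-n, n[]. The identity, seen as the pair of the
    coordinates, is then measurable into the product sigma-algebra. *)
Lemma measurable_boxesE : @measurable _ (mplane R) = <<s open_boxes >>.
Proof.
apply/seteqP; split; last first.
  apply: smallest_sub; first exact: sigma_algebra_measurable.
  by move=> _ [a [b [c [d ->]]]]; exact: measurable_box.
pose T := g_sigma_algebraType open_boxes.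
have mfst : measurable_fun (setT : set T) (fst : T -> measurableTypeR R).
  apply: (measurability _ (RGenOpens.measurableE R)) => _ [_ [a [b ->] <-]].
  rewrite setTI (_ : _ @^-1` _ = \bigcup_n (box a b (- n%:R) n%:R)).
    by apply: bigcup_measurable => n _; apply: sub_sigma_algebra; do 4 eexists.
  apply/seteqP; split => [x xab|x [n _ []]//].
  exists (Num.bound x.2) => //; split => //=; rewrite in_itv/= -ltr_norml.
  exact: unstable.ltr_norm_bound.
have msnd : measurable_fun (setT : set T) (snd : T -> measurableTypeR R).
  apply: (measurability _ (RGenOpens.measurableE R)) => _ [_ [a [b ->] <-]].
  rewrite setTI (_ : _ @^-1` _ = \bigcup_n (box (- n%:R) n%:R a b)).
    by apply: bigcup_measurable => n _; apply: sub_sigma_algebra; do 4 eexists.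
  apply/seteqP; split => [x xab|x [n _ []]//].
  exists (Num.bound x.1) => //; split => //=; rewrite in_itv/= -ltr_norml.
  exact: unstable.ltr_norm_bound.
move=> A mA; have := measurable_fun_pair mfst msnd measurableT mA.
by rewrite setTI (_ : _ @^-1` A = A)//; apply/seteqP; split => -[].
Qed.

(** An exhaustion of the open quadrant by sets that stay away from the axes and from infinity, on
    which Radon measures of the quadrant are finite. *)
Definition inner_box (n : nat) : set (R * R) :=
  box n.+1%:R^-1 n.+1%:R n.+1%:R^-1 n.+1%:R.

Lemma bigcup_inner_box : \bigcup_n inner_box n = @Rpos2 R.
Proof.
apply/seteqP; split => [x [n _ [/=]]|x [x1 x2]].
  rewrite !in_itv/= => /andP[h1 _] /andP[h2 _].
  by split; [apply: lt_trans h1|apply: lt_trans h2]; rewrite invr_gt0 ltr0Sn.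
pose B (t : R) : nat := maxn (Num.bound t) (Num.bound t^-1).
have bB (t : R) n : 0 < t -> (B t <= n)%N -> n.+1%:R^-1 < t < n.+1%:R.
  move=> t0; rewrite geq_max => /andP[h1 h2]; apply/andP; split.
    rewrite invf_plt ?posrE ?ltr0Sn//.
    by apply: lt_le_trans (unstable.ltr_bound _) _; rewrite ler_nat ltnW.
  by apply: lt_le_trans (unstable.ltr_bound _) _; rewrite ler_nat ltnW.
exists (maxn (B x.1) (B x.2)) => //; split; rewrite /= in_itv/= bB//.
  exact: leq_maxl.
exact: leq_maxr.
Qed.

Lemma nondecreasing_inner_box : {homo inner_box : n m / (n <= m)%N >-> (n <= m)%O}.
Proof.
move=> n m nm; apply/subsetPset => x [/=]; rewrite !in_itv/=.
move=> /andP[h1 h2] /andP[h3 h4].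
have h : m.+1%:R^-1 <= n.+1%:R^-1 :> R by rewrite lef_pV2 ?posrE ?ltr0Sn// ler_nat.
have h' : n.+1%:R <= m.+1%:R :> R by rewrite ler_nat.
by split; rewrite /= in_itv/=; apply/andP; split;
  by [exact: le_lt_trans h1|exact: lt_le_trans h'|exact: le_lt_trans h3].
Qed.

(** Uniqueness of measures on a pi-system asks for agreement on all boxes of the plane and for
    finiteness along an exhaustion of the plane. Restricting both measures to [inner_box n] provides
    this: the intersection of any box with [inner_box n] is a box with positive lower left corner,
    to which the hypotheses apply. Continuity from below then removes the restriction. *)
Lemma eq_measure_boxes (m1 m2 : {measure set (mplane R) -> \bar R}) :
  (forall a b c d, 0 < a -> 0 < c -> (m1 (box a b c d) < +oo)%E) ->
  (forall a b c d, 0 < a -> 0 < c -> m1 (box a b c d) = m2 (box a b c d)) ->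
  forall A : set (mplane R), measurable A -> A `<=` @Rpos2 R -> m1 A = m2 A.
Proof.
move=> m1oo m12 A mA AP.
have i0 n : 0 < n.+1%:R^-1 :> R by rewrite invr_gt0 ltr0Sn.
have mI n : measurable (inner_box n : set (mplane R)) by exact: measurable_box.
have H n : m1 (A `&` inner_box n) = m2 (A `&` inner_box n).
  have := @measure_unique _ R (mplane R) open_boxes
    (fun k => box (- k%:R) k%:R (- k%:R) k%:R) measurable_boxesE
    setI_closed_boxes _ _ (mrestr m1 (mI n)) (mrestr m2 (mI n)) _ _ A mA.
  apply.
  - by move=> k; do 4 eexists.
  - apply/seteqP; split => // x _.
    exists (maxn (Num.bound x.1) (Num.bound x.2)) => //.
    split; rewrite /= in_itv/= -ltr_norml (lt_le_trans (unstable.ltr_norm_bound _))// ler_nat.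
      exact: leq_maxl.
    exact: leq_maxr.
  - move=> _ [a [b [c [d ->]]]]; rewrite /= /mrestr boxI m12// lt_max i0 orbT//.
  - move=> k; rewrite /= /mrestr boxI m1oo// lt_max i0 orbT//.
have cvg (m : {measure set (mplane R) -> \bar R}) :
    m (A `&` inner_box n) @[n --> \oo] --> m A.
  have AE : A = \bigcup_n (A `&` inner_box n).
    by rewrite -setI_bigcupr bigcup_inner_box setIidl.
  rewrite [in X in _ --> X]AE; apply: nondecreasing_cvg_mu.
  - by move=> n; exact: measurableI.
  - by rewrite -AE.
  - move=> n k nk; apply/subsetPset; apply: setIS.
    exact/subsetPset/nondecreasing_inner_box.
have := cvg m2; under eq_cvg do rewrite -H.
by apply: cvg_unique; [exact: ereal_hausdorff|exact: cvg].
Qed.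

(** Dominated convergence on the closed box, with [|g|] as dominating function: the bumps lie
    between 0 and 1 and vanish off the open box. *)
Lemma box_bump_Rint_cvg (m : {measure set (mplane R) -> \bar R}) (g : mplane R -> R) a b c d :
  0 < a -> 0 < c -> m.-integrable (`[a, b] `*` `[c, d]) (EFin \o g) ->
  \int[m]_(x in @Rpos2 R) (g x * box_bump a b c d n x) @[n --> \oo] -->
  \int[m]_(x in box a b c d) g x.
Proof.
move=> a0 c0 ig.
pose K : set (mplane R) := `[a, b] `*` `[c, d].
have mK : measurable K by exact: measurableX.
have bK : box a b c d `<=` K by exact: box_sub.
have -> : \int[m]_(x in box a b c d) g x = \int[m]_(x in K) (g x * \1_(box a b c d) x).
  rewrite (@Rintegral_support _ _ _ m K (box a b c d))//.
    by apply: eq_Rintegral => x xb; rewrite indicE xb mulr1.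
  by move=> x _ nb; rewrite indicE memNset// mulr0.
rewrite [X in X @ \oo](_ : _ =
    fun n => \int[m]_(x in K) (g x * box_bump a b c d n x)); last first.
  apply/funext => n; apply: Rintegral_support.
    by move=> x; exact: cbox_Rpos2.
  by move=> x _ nK; rewrite box_bump0 ?mulr0//; apply: contra_not nK; exact: bK.
have mg : measurable_fun K g by apply/measurable_EFinP; exact: measurable_int ig.
have [] := @dominated_convergence _ _ R m K mK
  (fun n x => (g x * box_bump a b c d n x)%:E)
  (fun x => (g x * \1_(box a b c d) x)%:E) (fun x => `|g x|%:E).
- move=> n; apply/measurable_EFinP; apply: measurable_funM => //.
  apply: measurable_funS (continuous_plane_measurable _) => //.
  by have [/(_ 0%N)[]] := box_bump_test b d n a0 c0.
- apply/measurable_EFinP; apply: measurable_funM => //.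
  by apply: measurable_indic; exact: measurable_box.
- apply: aeW => x Kx; apply: cvg_EFin; first exact: nearW.
  by apply: cvgMl_tmp; exact: box_bump_cvg.
- exact: (integrable_abse ig).
- apply: aeW => x n Kx; rewrite /= lee_fin normrM ler_piMr//.
  by rewrite ger0_norm ?box_bump_ge0// box_bump_le1.
move=> ii _ h; rewrite /Rintegral; apply: fine_cvg; rewrite fineK//.
exact: integrable_fin_num.
Qed.

End boxes.

(** * Uniqueness of weak gradients and of Hessian measures *)

Section uniqueness.
Variable R : realType.
Implicit Types (A K : set (mplane R)).

Lemma bounded_borelS (E A B : set (mplane R)) : bounded_borel E A ->
  measurable B -> B `<=` A -> bounded_borel E B.
Proof.
move=> [mA [K [cK AK KE]]] mB BA; split => //.
by exists K; split => //; exact: subset_trans AK.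
Qed.

Lemma bounded_borelW A : bounded_borel (@Rpos2 R) A -> bounded_borel (@Rplus2 R) A.
Proof.
move=> [mA [K [cK AK KP]]]; split => //; exists K; split => //.
by apply: subset_trans KP _; exact: sub_Rpos2_Rplus2.
Qed.

Lemma bounded_borel_box (a b c d : R) : 0 < a -> 0 < c ->
  bounded_borel (@Rpos2 R) (box a b c d).
Proof.
move=> a0 c0; split; first exact: measurable_box.
exists (`[a, b] `*` `[c, d]); split; [exact: box_compact|exact: box_sub|].
exact: cbox_Rpos2.
Qed.

Lemma bounded_borel_cbox (a b c d : R) : 0 < a -> 0 < c ->
  bounded_borel (@Rpos2 R) (`[a, b] `*` `[c, d]).
Proof.
move=> a0 c0; split; first exact: measurableX.
by exists (`[a, b] `*` `[c, d]); split => //; [exact: box_compact|exact: cbox_Rpos2].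
Qed.

Lemma radon_on_lty E (m : {measure set (mplane R) -> \bar R}) A :
  radon_on E m -> bounded_borel E A -> (m A < +oo)%E.
Proof.
move=> [_ mfin] [mA [K [cK AK KE]]].
apply: le_lt_trans (mfin K cK KE); apply: le_measure; rewrite ?inE//.
exact: compact_plane_measurable.
Qed.

Lemma radon_on_fin E (m : {measure set (mplane R) -> \bar R}) A :
  radon_on E m -> bounded_borel E A -> m A \is a fin_num.
Proof.
by move=> rm bA; rewrite ge0_fin_numE ?measure_ge0//; exact: radon_on_lty bA.
Qed.

(** On bounded sets the four values are finite, so negative parts can change sides. The resulting
    equality of sums, unlike the one of differences, can be extended to unbounded sets. *)
Lemma sr_val_eqE E E' (H : signed_radon E) (H' : signed_radon E') A :
  bounded_borel E A -> bounded_borel E' A ->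
  sr_val H A = sr_val H' A <->
  (sr_pos H A + sr_neg H' A = sr_pos H' A + sr_neg H A)%E.
Proof.
move=> bA bA'; rewrite /sr_val.
rewrite -(fineK (radon_on_fin (sr_pos_radon H) bA)).
rewrite -(fineK (radon_on_fin (sr_neg_radon H) bA)).
rewrite -(fineK (radon_on_fin (sr_pos_radon H') bA')).
rewrite -(fineK (radon_on_fin (sr_neg_radon H') bA')) /= -!EFinD.
by split => [h|[h]]; [congr EFin|]; lra.
Qed.

(** Both sides are positive measures, finite on boxes with positive lower left corner, so
    [eq_measure_boxes] applies. The set [A] may be unbounded or touch the axes in its closure. *)
Lemma eq_sr_val_boxes E (H H' : signed_radon E) : @Rpos2 R `<=` E ->
  (forall a b c d : R, 0 < a -> 0 < c -> sr_val H (box a b c d) = sr_val H' (box a b c d)) ->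
  forall A, measurable A -> A `<=` @Rpos2 R ->
    (sr_pos H A + sr_neg H' A = sr_pos H' A + sr_neg H A)%E.
Proof.
move=> PE HH' A mA AP.
have bE (a b c d : R) : 0 < a -> 0 < c -> bounded_borel E (box a b c d).
  move=> a0 c0; have [mB [K [cK BK KP]]] := bounded_borel_box b d a0 c0.
  by split => //; exists K; split => //; exact: subset_trans PE.
pose sum (H1 H2 : signed_radon E) : {measure set (mplane R) -> \bar R} :=
  measure_add (sr_pos H1) (sr_neg H2).
have sumE H1 H2 B : sum H1 H2 B = (sr_pos H1 B + sr_neg H2 B)%E.
  exact: measure_addE.
rewrite -!sumE; apply: eq_measure_boxes => //.
- move=> a b c d a0 c0; rewrite sumE lte_add_pinfty//.
    by apply: radon_on_lty (sr_pos_radon H) _; exact: bE.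
  by apply: radon_on_lty (sr_neg_radon H') _; exact: bE.
- move=> a b c d a0 c0; rewrite !sumE.
  by apply/sr_val_eqE; [exact: bE|exact: bE|exact: HH'].
Qed.

(** A fundamental lemma of the calculus of variations with boxes as test sets: [h^+ dm] and [h^- dm]
    agree on boxes, hence on Borel subsets of the open quadrant, so [h] has zero integral over every
    measurable subset of [A]. *)
Lemma ae_eq0_boxes (m : {measure set (mplane R) -> \bar R}) (h : mplane R -> R) :
  measurable_fun (@Rpos2 R : set (mplane R)) h ->
  (forall A, bounded_borel (@Rpos2 R) A -> m.-integrable A (EFin \o h)) ->
  (forall a b c d : R, 0 < a -> 0 < c -> \int[m]_(x in box a b c d) h x = 0) ->
  forall A, bounded_borel (@Rpos2 R) A -> ae_eq m A (EFin \o h) (cst 0%E).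
Proof.
move=> mh ih h0 A bA; have mA := bA.1.
have mP := @measurable_Rpos2 R.
have bP B : bounded_borel (@Rpos2 R) B -> B `<=` @Rpos2 R.
  by move=> [_ [K [_ BK KP]]]; exact: subset_trans KP.
have fin B (h' : mplane R -> R) (mh' : measurable_fun (@Rpos2 R : set (mplane R)) h') :
    bounded_borel (@Rpos2 R) B -> m.-integrable B (EFin \o h') ->
    (pos_density m mP mh' B < +oo)%E.
  move=> bB ih'; apply: pos_density_lty; first exact: bB.1.
  by rewrite setIidl//; exact: bP.
have mhN := measurable_oppD mh.
have ihN B : bounded_borel (@Rpos2 R) B -> m.-integrable B (EFin \o (fun x => - h x)).
  by move=> /ih /integrableN.
have E0 B : bounded_borel (@Rpos2 R) B ->
    pos_density m mP mh B = pos_density m mP mhN B -> \int[m]_(x in B) h x = 0.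
  move=> bB; rewrite -(pos_densityB mP mh mhN bB.1 (bP _ bB) (ih _ bB)) => ->.
  by rewrite subrr.
apply: integral_ae_eq => //; first exact: ih.
move=> B BA mB; have bB := bounded_borelS bA mB BA.
rewrite integral0 -[LHS]fineK; last by apply: integrable_fin_num => //; exact: ih.
congr EFin; apply: (E0 _ bB).
apply: (@eq_measure_boxes R (pos_density m mP mh) (pos_density m mP mhN)) => //.
- move=> a b c d a0 c0; apply: fin; first exact: bounded_borel_box.
  by apply: ih; exact: bounded_borel_box.
- move=> a b c d a0 c0; have bB' := bounded_borel_box b d a0 c0.
  have := pos_densityB mP mh mhN bB'.1 (bP _ bB') (ih _ bB').
  rewrite h0// => /subr0_eq.
  have f1 := fin _ _ mh bB' (ih _ bB'); have f2 := fin _ _ mhN bB' (ihN _ bB').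
  move=> E; rewrite -[LHS]fineK ?ge0_fin_numE ?measure_ge0//.
  by rewrite E fineK// ge0_fin_numE ?measure_ge0.
- exact: bP.
Qed.

Lemma weak_gradient_ae_eq (f : R * R -> R) (g g' : 'I_2 -> R * R -> R) i A :
  weak_gradient f g -> weak_gradient f g' -> bounded_borel (@Rpos2 R) A ->
  ae_eq (leb2 R) A (EFin \o (fun x => g i x - g' i x)) (cst 0%E).
Proof.
move=> /(_ i)[mg ig wg] /(_ i)[mg' ig' wg'] bA.
apply: ae_eq0_boxes => //.
- exact: measurable_funB.
- by move=> B bB; exact: (integrableB bB.1 (ig _ bB) (ig' _ bB)).
- move=> a b c d a0 c0; have bB := bounded_borel_box b d a0 c0.
  have bK := bounded_borel_cbox b d a0 c0.
  rewrite RintegralB//; [|exact: bB.1|exact: ig|exact: ig'].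
  have h := @box_bump_Rint_cvg R (leb2 R) (g i) a b c d a0 c0 (ig _ bK).
  have h' := @box_bump_Rint_cvg R (leb2 R) (g' i) a b c d a0 c0 (ig' _ bK).
  apply/eqP; rewrite subr_eq0; apply/eqP.
  apply: (cvg_unique _ h) => //.
  have E n : \int[leb2 R]_(x in @Rpos2 R) (g i x * box_bump a b c d n x) =
      \int[leb2 R]_(x in @Rpos2 R) (g' i x * box_bump a b c d n x).
    have tn := @box_bump_test R a b c d n a0 c0.
    by apply: oppr_inj; rewrite -wg// wg'.
  by rewrite /=; under eq_cvg do rewrite E.
Qed.

(** Test functions approximating a box give [H i j] and [H' i j] the same value on it, so the
    positive part of each plus the negative part of the other is one and the same measure on the
    open quadrant. Integrating [h] against this measure gives the claim; boundedness of [h] on [A]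
    makes all four integrals finite, so that they can be rearranged. *)
Lemma hessian_measure_eq (f : R * R -> R) H H' i j A (h : mplane R -> R) (M : R) :
  hessian_measure f H -> hessian_measure f H' -> bounded_borel (@Rpos2 R) A ->
  measurable_fun A h -> (forall x, A x -> `|h x| <= M) ->
  sr_int (H i j) A h = sr_int (H' i j) A h.
Proof.
move=> hH hH' bA mh hM; have mA := bA.1.
have ih (m : {measure set (mplane R) -> \bar R}) : radon_on (@Rpos2 R) m ->
    m.-integrable A (EFin \o h).
  move=> rm; apply: (@bounded_plane_integrable R m A A h M) => //.
  exact: radon_on_lty bA.
have AP : A `<=` @Rpos2 R by case: bA => _ [K [_ AK KP]]; exact: subset_trans KP.
have cvgH (m : {measure set (mplane R) -> \bar R}) (a b c d : R) : radon_on (@Rpos2 R) m ->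
    0 < a -> 0 < c ->
    \int[m]_(x in @Rpos2 R) box_bump a b c d n x @[n --> \oo] --> fine (m (box a b c d)).
  move=> rm a0 c0; have bK := bounded_borel_cbox b d a0 c0.
  have := @box_bump_Rint_cvg R m (cst 1) a b c d a0 c0.
  rewrite Rintegral_cst ?mul1r; last exact: measurable_box.
  under eq_cvg do under eq_Rintegral do rewrite mul1r.
  apply; apply: (@bounded_plane_integrable R m _ (`[a, b] `*` `[c, d]) _ 1) => //.
  - exact: bK.1.
  - exact: bK.1.
  - exact: radon_on_lty bK.
  - by move=> x _ /=; rewrite normr1.
have E := @eq_sr_val_boxes (@Rpos2 R) (H i j) (H' i j) (@subset_refl _ _) _.
have {}E : forall B, measurable B -> B `<=` @Rpos2 R ->
    (sr_pos (H i j) B + sr_neg (H' i j) B = sr_pos (H' i j) B + sr_neg (H i j) B)%E.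
  apply: E => a b c d a0 c0.
  have L (H0 : signed_radon (@Rpos2 R)) :
      sr_int H0 (@Rpos2 R) (box_bump a b c d n) @[n --> \oo] --> sr_val H0 (box a b c d).
    by apply: cvgB; apply: cvgH => //; [exact: sr_pos_radon|exact: sr_neg_radon].
  apply: (cvg_unique _ (L (H i j))) => //.
  have E n : sr_int (H i j) (@Rpos2 R) (box_bump a b c d n) =
      sr_int (H' i j) (@Rpos2 R) (box_bump a b c d n).
    have tn := @box_bump_test R a b c d n a0 c0.
    by rewrite -hH// hH'.
  by rewrite /=; under eq_cvg do rewrite E; exact: L.
rewrite /sr_int; apply/eqP; rewrite subr_eq addrAC eq_sym subr_eq; apply/eqP.
have add (H1 H2 : signed_radon (@Rpos2 R)) :
    \int[measure_add (sr_pos H1) (sr_neg H2)]_(x in A) h x =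
    \int[sr_pos H1]_(x in A) h x + \int[sr_neg H2]_(x in A) h x.
  have i1 := ih _ (sr_pos_radon H1); have i2 := ih _ (sr_neg_radon H2).
  rewrite /Rintegral integral_measure_add// fineD//; exact: integrable_fin_num.
rewrite -!add /Rintegral; congr fine; apply: eq_measure_integral => B mB BA.
have sumE H1 H2 : measure_add (sr_pos H1) (sr_neg H2) B =
    (sr_pos H1 B + sr_neg H2 B)%E by exact: measure_addE.
by rewrite [LHS]sumE [RHS]sumE E//; exact: subset_trans AP.
Qed.

End uniqueness.

(** * Arc length on the diagonal *)

Section null_sets.
Variable R : realType.

Lemma lebesgue_segment_lty (a b : R) : (@lebesgue_measure R `[a, b]%classic < +oo)%E.
Proof.
rewrite lebesgue_measure_itv/= lte_fin; case: ifP => // _.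
by rewrite -EFinB ltry.
Qed.

Lemma leb2X (A B : set (measurableTypeR R)) : measurable A -> measurable B ->
  leb2 R (A `*` B) = (@lebesgue_measure R A * @lebesgue_measure R B)%E.
Proof. exact: product_measure1E. Qed.

Lemma leb2_axes (A : set (mplane R)) : measurable A ->
  A `<=` @Rplus2 R -> A `&` @Rpos2 R = set0 -> leb2 R A = 0%E.
Proof.
move=> mA AP A0.
pose B : set (mplane R) := [set 0] `*` setT `|` setT `*` [set 0].
have m1 := measurable_set1 (0 : measurableTypeR R).
have mB : measurable B by apply: measurableU; exact: measurableX.
apply: (@subset_measure0 _ _ _ (leb2 R) A B) => //.
- move=> x Ax; have [x1 x2] := AP _ Ax.
  have [x10|/eqP x10] := eqVneq x.1 0; first by left.
  have [x20|/eqP x20] := eqVneq x.2 0; first by right.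
  suff : (A `&` @Rpos2 R) x by rewrite A0.
  by split => //; split; rewrite lt_neqAle; [rewrite x1|rewrite x2];
    rewrite andbT eq_sym; exact/eqP.
- apply: (@null_set_setU _ _ _ (leb2 R)); [exact: measurableX|exact: measurableX| |].
    by rewrite leb2X// lebesgue_measure_set1 mul0e.
  by rewrite leb2X// lebesgue_measure_set1 mule0.
Qed.

Lemma leb2_compact (K : set (R * R)) : compact K -> (leb2 R K < +oo)%E.
Proof.
move=> cK; have [M M0 KM] := compact_plane_box cK.
have mI := measurable_itv `[- M, M].
apply: (@le_lt_trans _ _ (leb2 R (`[- M, M] `*` `[- M, M]))).
  apply: le_measure; rewrite ?inE; [exact: compact_plane_measurable|exact: measurableX|].
  by move=> x /KM[h1 h2]; split; rewrite /= in_itv/= -ler_norml ltW.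
by rewrite leb2X// lte_mul_pinfty ?ge0_fin_numE// lebesgue_segment_lty.
Qed.

Lemma leb2_bounded_borel (E A : set (mplane R)) : bounded_borel E A -> (leb2 R A < +oo)%E.
Proof.
move=> [mA [K [cK AK _]]]; apply: le_lt_trans (leb2_compact cK).
by apply: le_measure; rewrite ?inE//; exact: compact_plane_measurable.
Qed.

End null_sets.

Section arc_length_theory.
Variables (R : realType) (alpha : R).
Hypothesis alpha0 : 0 < alpha.

Local Notation k := (Num.sqrt (1 + alpha ^+ 2)).
Local Notation arc := (arc_length alpha).

Lemma diag_norm_gt0 : 0 < k.
Proof. by rewrite sqrtr_gt0 ltr_wpDr// sqr_ge0. Qed.

Let k0 := diag_norm_gt0.

Lemma diag_ray_Diag (s : R) : 0 <= s -> Diag alpha (diag_ray alpha s).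
Proof.
move=> s0; split; last by rewrite /diag_ray/=; ring.
by split; rewrite /diag_ray/= mulr_ge0// ?divr_ge0 ?invr_ge0 ?ltW.
Qed.

Lemma diag_ray_Rpos2 (s : R) : Rpos2 (diag_ray alpha s) <-> 0 < s.
Proof.
split => [[_]|s0]; rewrite /diag_ray/=; first by rewrite pmulr_lgt0 ?invr_gt0.
by split; rewrite /= mulr_gt0// ?divr_gt0 ?invr_gt0.
Qed.

Lemma Diag_closed : closed (Diag alpha).
Proof.
rewrite (_ : Diag alpha = @Rplus2 R `&` (fun x => x.1 - alpha * x.2) @^-1` [set 0]).
  apply: closedI; first exact: closed_Rplus2.
  apply: closed_comp; last exact: closed_eq.
  move=> x _; apply: cvgB; first exact: cvg_fst.
  by apply: cvgMl_tmp; exact: cvg_snd.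
apply/seteqP; split => x [xP] /= => [->|/subr0_eq//]; split => //=.
by rewrite subrr.
Qed.

Lemma measurable_Diag : measurable (Diag alpha : set (mplane R)).
Proof. by apply: closed_plane_measurable; exact: Diag_closed. Qed.

(** The section at first coordinate [x] is contained in the single point [x / alpha]. *)
Lemma leb2_Diag : leb2 R (Diag alpha) = 0%E.
Proof.
rewrite /leb2 /product_measure1 -[RHS](@integral0 _ _ R (@lebesgue_measure R) setT).
apply: eq_integral => x _ /=.
apply: (@subset_measure0 _ _ _ (@lebesgue_measure R) _ [set x / alpha]) => //.
- by apply: measurable_xsection; exact: measurable_Diag.
- move=> y /=; rewrite /xsection/= inE => -[_ /= ->].
  by rewrite mulrAC mulfV ?mul1r ?gt_eqF.
- exact: lebesgue_measure_set1.
Qed.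

Lemma measurable_ray (A : set (mplane R)) : measurable A ->
  measurable (diag_ray alpha @^-1` A).
Proof. by move=> mA; rewrite -[X in measurable X]setTI; exact: measurable_diag_ray. Qed.

Lemma arc_offDiag (A : set (mplane R)) : A `<=` ~` Diag alpha -> arc A = 0%E.
Proof.
move=> AD; rewrite /arc_length /pushforward /mrestr.
rewrite (_ : _ `&` _ = set0) ?measure0//.
apply/seteqP; split => // s [/= As]; rewrite in_itv/= andbT => s0.
exact: (AD _ As (diag_ray_Diag s0)).
Qed.

(** The ray enters the open quadrant as soon as [s > 0], so at most the null set of parameters
    [s = 0] is sent into [A]: the origin is the only point of the diagonal on the axes. *)
Lemma arc_offRpos2 (A : set (mplane R)) : measurable A -> A `&` @Rpos2 R = set0 ->
  arc A = 0%E.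
Proof.
move=> mA A0; rewrite /arc_length /pushforward /mrestr.
apply: (@subset_measure0 _ _ _ (@lebesgue_measure R) _ [set 0]) => //.
- by apply: measurableI => //; exact: measurable_ray.
- move=> s [/= As]; rewrite in_itv/= andbT le_eqVlt => /predU1P[//|s0].
  suff : (A `&` @Rpos2 R) (diag_ray alpha s) by rewrite A0.
  by split => //; apply/diag_ray_Rpos2.
- exact: lebesgue_measure_set1.
Qed.

Lemma arc_compact (K : set (R * R)) : compact K -> (arc K < +oo)%E.
Proof.
move=> cK; have [M M0 KM] := compact_plane_box cK.
rewrite /arc_length /pushforward /mrestr.
(* The second coordinate on the ray is [s / k], and it is less than [M] on [K]. *)
apply: (@le_lt_trans _ _ (@lebesgue_measure R `[0, M * k])).
  apply: le_measure; rewrite ?inE//.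
    by apply: measurableI => //; apply: measurable_ray; exact: compact_plane_measurable.
  move=> s [/= /KM[_ h]]; rewrite !in_itv/= andbT => s0; rewrite s0/=.
  have r0 : 0 <= k^-1 by rewrite invr_ge0 ltW.
  move: h; rewrite /diag_ray/= ger0_norm ?mulr_ge0//.
  by rewrite ltr_pdivrMr// => /ltW.
exact: lebesgue_segment_lty.
Qed.

Lemma arc_radon_Rpos2 : radon_on (@Rpos2 R) arc.
Proof.
split => [|K cK _]; last exact: arc_compact.
apply: arc_offRpos2; first by apply: measurableC; exact: measurable_Rpos2.
by rewrite setICl.
Qed.

End arc_length_theory.

(** * Weak derivatives of the maximum *)

Section integrals_on_the_line.
Variable R : realType.
Local Notation leb := (@lebesgue_measure R).
Implicit Types (f h : R -> R) (M C a b c s t tau : R).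

Lemma integrable_supp f M C : measurable_fun setT f -> (forall t, `|f t| <= C) ->
  (forall t, M <= `|t| -> f t = 0) -> leb.-integrable setT (EFin \o f).
Proof.
move=> mf fC f0; pose I : set (measurableTypeR R) := `[- M, M]%classic.
have mI : measurable I by exact: measurable_itv.
have -> : EFin \o f = (EFin \o f) \_ I.
  apply/funext => t; rewrite patchE; case: ifPn => //= /negP tM.
  rewrite f0//; rewrite leNgt; apply: contra_notN tM => tM.
  by rewrite inE /I/= in_itv/= -ler_norml ltW.
apply: (@integrable_mkcond _ _ R leb I (EFin \o f) mI).1.
apply: measurable_bounded_integrable => //.
- exact: lebesgue_segment_lty.
- exact: measurable_funTS.
- exists C; split; first exact: num_real.
  by move=> y Cy t _ /=; rewrite (le_trans (fC t))// ltW.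
Qed.

Lemma segment_integrable f a b : continuous f -> leb.-integrable `[a, b] (EFin \o f).
Proof.
move=> cf; apply: continuous_compact_integrable; first exact: segment_compact.
exact: continuous_subspaceT.
Qed.

Lemma continuous_supp_bounded f M : continuous f ->
  (forall t, M <= `|t| -> f t = 0) -> exists C, forall t, `|f t| <= C.
Proof.
move=> cf f0.
have /compact_bounded[C [_ hC]] : compact (f @` `[- M, M]).
  by apply: continuous_compact; [exact: continuous_subspaceT|exact: segment_compact].
exists (`|C| + 1) => t.
have h : C < `|C| + 1 by rewrite (le_lt_trans (ler_norm _))// ltrDl.
have [tM|tM] := leP M `|t|; first by rewrite f0// normr0 addr_ge0.
by apply: (hC _ h); exists t => //; rewrite /= in_itv/= -ler_norml ltW.
Qed.

Lemma continuous_supp_integrable (g : R -> R) f M :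
  measurable_fun setT g -> (forall t, `|g t| <= 1) ->
  continuous f -> (forall t, M <= `|t| -> f t = 0) ->
  leb.-integrable setT (EFin \o (fun t => g t * f t)).
Proof.
move=> mg g1 cf f0; have [C fC] := continuous_supp_bounded cf f0.
apply: (@integrable_supp _ M C).
- by apply: measurable_funM => //; exact: continuous_measurable_fun.
- by move=> t; rewrite normrM (le_trans _ (fC t))// ler_piMl.
- by move=> t /f0 ->; rewrite mulr0.
Qed.

(** Reduction of a half-line to a segment, where the fundamental theorem of calculus applies; the
    endpoint [tau] excluded by the strict inequality is a null set. *)
Lemma Rintegral_gt tau b f : tau < b -> continuous f -> (forall t, b < t -> f t = 0) ->
  \int[leb]_t ((tau < t)%R%:R * f t) = \int[leb]_(t in `[tau, b]) f t.
Proof.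
move=> tb cf f0.
rewrite (@Rintegral_support _ _ _ leb setT `]tau, b])//; last first.
  move=> t _ /= /negP; rewrite in_itv/= negb_and => /orP[/negbTE ->|]; rewrite ?mul0r//.
  by rewrite -ltNge => /f0 ->; rewrite mulr0.
rewrite -Rintegral_itv_obnd_cbnd; last first.
  by apply: integrableS (segment_integrable tau b cf) => //; exact: subset_itv_oc_cc.
by apply: eq_Rintegral => t; rewrite inE/= in_itv/= => /andP[-> _]; rewrite mul1r.
Qed.

Lemma Rintegral_lt tau b f : b < tau -> continuous f -> (forall t, t < b -> f t = 0) ->
  \int[leb]_t ((t < tau)%R%:R * f t) = \int[leb]_(t in `[b, tau]) f t.
Proof.
move=> tb cf f0.
rewrite (@Rintegral_support _ _ _ leb setT `[b, tau[)//; last first.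
  move=> t _ /= /negP; rewrite in_itv/= negb_and => /orP[|/negbTE ->]; rewrite ?mul0r//.
  by rewrite -ltNge => /f0 ->; rewrite mulr0.
rewrite -Rintegral_itv_bndo_bndc; last first.
  by apply: integrableS (segment_integrable b tau cf) => //; exact: subset_itv_co_cc.
by apply: eq_Rintegral => t; rewrite inE/= in_itv/= => /andP[_ ->]; rewrite mul1r.
Qed.

Section compactly_supported.
Variables (psi dpsi : R -> R) (M : R).
Hypotheses (Dpsi : forall t, is_derive t 1 psi (dpsi t)) (cdpsi : continuous dpsi).
Hypotheses (psi0 : forall t, M <= `|t| -> psi t = 0) (dpsi0 : forall t, M <= `|t| -> dpsi t = 0).

Let cpsi : continuous psi.
Proof.
move=> t; apply/differentiable_continuous/derivable1_diffP.
by have [] := Dpsi t.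
Qed.

Let psi_LR a b : derivable_oo_LRcontinuous psi a b.
Proof.
split; [|exact/cvg_at_right_filter/cpsi|exact/cvg_at_left_filter/cpsi].
by move=> t _; have [] := Dpsi t.
Qed.

Let dpsiE a b : {in `]a, b[, psi^`()%classic =1 dpsi}.
Proof. by move=> t _; rewrite derive1E; have [] := Dpsi t. Qed.

Let FTC a b : a < b -> \int[leb]_(t in `[a, b]) dpsi t = psi b - psi a.
Proof.
move=> ab; rewrite /Rintegral (continuous_FTC2 ab _ (psi_LR a b) (@dpsiE a b))//.
exact: continuous_subspaceT.
Qed.

(** A point to the right of [tau] at which the functions have already vanished; [+ 1] makes the
    inequality with [tau] strict, and [|M|] is taken because [M] has no prescribed sign. *)
Let big tau := Num.max `|tau| `|M| + 1.

Let bigP tau t : big tau <= t -> tau < t /\ M <= `|t|.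
Proof.
rewrite /big => h; split.
  rewrite (le_lt_trans (ler_norm tau))// (lt_le_trans _ h)// ltr_pwDr//.
  by rewrite le_max lexx.
rewrite (le_trans (ler_norm M))// (le_trans _ (ler_norm t))// (le_trans _ h)//.
by rewrite ler_wpDr// le_max lexx orbT.
Qed.

Lemma Rintegral_gt_deriv tau : \int[leb]_t ((tau < t)%R%:R * dpsi t) = - psi tau.
Proof.
have [tb Mb] := bigP (lexx (big tau)).
rewrite (Rintegral_gt tb)//; last by move=> t /ltW/bigP[_]; exact: dpsi0.
by rewrite FTC// psi0// sub0r.
Qed.

Lemma Rintegral_lt_deriv tau : \int[leb]_t ((t < tau)%R%:R * dpsi t) = psi tau.
Proof.
(* The mirror image [- big (- tau)] lies to the left of [tau] and, likewise, where the functions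
   vanish. *)
have [] := bigP (lexx (big (- tau))); rewrite ltrNl => tb Mb.
rewrite (Rintegral_lt tb)//.
  by rewrite FTC// (psi0 (t := - _)) ?normrN// subr0.
by move=> t; rewrite ltrNr => /ltW/bigP[_]; rewrite normrN; exact: dpsi0.
Qed.

Lemma Rintegral_deriv : \int[leb]_t dpsi t = 0.
Proof.
have [_ Mb] := bigP (lexx (big M)).
have : \int[leb]_t ((- big M < t)%R%:R * dpsi t) = 0.
  by rewrite Rintegral_gt_deriv psi0 ?oppr0// normrN.
move=> <-; apply: eq_Rintegral => t _.
have [bt|tb] := ltP; first by rewrite mul1r.
rewrite dpsi0 ?mulr0//; move: tb; rewrite lerNr => /bigP[_].
by rewrite normrN.
Qed.

(** On each line parallel to an axis, [maxG alpha] is such a ramp with kink at [tau]. The constant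
    [beta] contributes 0 because [dpsi] has zero integral. Integration by parts of [t - tau] against
    [dpsi] on [[tau, big tau]] leaves no boundary term: [t - tau] vanishes at the left end and [psi]
    at the right end. *)
Lemma Rintegral_ramp_deriv (a beta tau : R) :
  \int[leb]_t ((a * Num.max (t - tau) 0 + beta) * dpsi t) =
  - \int[leb]_t (a * (tau < t)%R%:R * psi t).
Proof.
have [tb Mb] := bigP (lexx (big tau)).
pose dl t := (t - tau) * dpsi t.
have cdl : continuous dl.
  by move=> t; apply: cvgM; [apply: cvgB; [exact: cvg_id|exact: cvg_cst]|exact: cdpsi].
have dl0 t : M <= `|t| -> dl t = 0 by rewrite /dl => /dpsi0 ->; rewrite mulr0.
have mgt : measurable_fun setT (fun t : R => (tau < t)%R%:R : R).
  rewrite (_ : (fun t => _) = \1_`]tau, +oo[); first exact: measurable_indic.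
  by apply/funext => t; rewrite indicE mem_setE in_itv/= andbT.
have gt1 t : `|(tau < t)%R%:R : R| <= 1 by case: (tau < t); rewrite ?normr1 ?normr0.
have i1 := continuous_supp_integrable mgt gt1 cdl dl0.
have i2 := continuous_supp_integrable mgt gt1 cpsi psi0.
have i3 : leb.-integrable setT (EFin \o (fun t => 1 * dpsi t)).
  apply: (@continuous_supp_integrable (cst 1)) cdpsi dpsi0 => //.
  by move=> t; rewrite normr1.
have E t : (a * Num.max (t - tau) 0 + beta) * dpsi t =
    a * ((tau < t)%R%:R * dl t) + beta * (1 * dpsi t).
  rewrite /dl; have [tt|tt] := ltP tau t.
    by rewrite max_l ?subr_ge0 ?ltW//=; ring.
  by rewrite max_r ?subr_le0//=; ring.
under eq_Rintegral do rewrite E.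
rewrite RintegralD//; [|exact: (integrableZl measurableT _ i1)|
  exact: (integrableZl measurableT _ i3)].
rewrite RintegralZl// RintegralZl//.
under [X in _ + _ * X]eq_Rintegral do rewrite mul1r.
rewrite Rintegral_deriv mulr0 addr0.
under [in RHS]eq_Rintegral do rewrite -mulrA.
rewrite RintegralZl// -mulrN; congr (a * _).
rewrite (Rintegral_gt tb)//; last by move=> t /ltW/bigP[_]; exact: dl0.
rewrite (Rintegral_gt tb)//; last by move=> t /ltW/bigP[_]; exact: psi0.
have dlin t : is_derive t 1 (fun t => t - tau) (1 : R).
  by apply: is_derive_eq; rewrite subr0.
have clin : continuous (fun t => t - tau).
  by move=> t; apply: cvgB; [exact: cvg_id|exact: cvg_cst].
rewrite (@Rintegration_by_parts R (fun t => t - tau) psi (cst 1) dpsi)//.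
- by rewrite psi0// subrr mulr0 mul0r subrr sub0r; under eq_Rintegral do rewrite mul1r.
- by apply: continuous_subspaceT => t; exact: cvg_cst.
- split; [by move=> t _; have [] := dlin t| |].
    exact/cvg_at_right_filter/clin.
  exact/cvg_at_left_filter/clin.
- by move=> t _; rewrite derive1E; have [] := dlin t.
- exact: continuous_subspaceT.
Qed.

End compactly_supported.

(** Linear substitution on a segment containing the support. It accounts for two constants:
    [c = alpha] changes the parameter of the diagonal from the first to the second coordinate, and
    [c = k^-1] passes to arc length. *)
Lemma Rintegral_dilation h M c : 0 < c -> continuous h ->
  (forall t, M <= `|t| -> h t = 0) -> \int[leb]_t h t = c * \int[leb]_t h (c * t).
Proof.
move=> c0 ch h0; pose N := `|M| + 1.
have hN t : ~ `[- N, N]%classic t -> h t = 0.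
  rewrite /= in_itv/= -ler_norml => /negP; rewrite -ltNge => Nt; apply: h0.
  by rewrite (le_trans (ler_norm M))// (le_trans _ (ltW Nt))// lerDl.
have N0 : 0 < N by rewrite ltr_wpDl.
rewrite (@Rintegral_support _ _ _ leb setT `[- N, N])//; last by move=> t _; exact: hN.
rewrite (@Rintegral_support _ _ _ leb setT `[- N / c, N / c] (fun t => h (c * t)))//; last first.
  move=> t _ nt; apply: hN; apply: contra_not nt; rewrite /= !in_itv/=.
  by rewrite ler_pdivrMr// ler_pdivlMr// !(mulrC t).
have dF t : is_derive t 1 (fun t => c * t) c.
  by apply: is_derive_eq; rewrite [_ *: _]mulr1.
have DF : (fun t => c * t)^`()%classic = cst c.
  by apply/funext => t; rewrite derive1E; have [] := dF t.
have cF : continuous (fun t : R => c * t).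
  by move=> t; apply: cvgMl_tmp; exact: cvg_id.
have := @integration_by_substitution_increasing R (fun t => c * t) h (- N / c) (N / c).
rewrite DF !(mulrC c) !divfK ?gt_eqF// => H.
rewrite [LHS]/Rintegral H.
- rewrite -RintegralZr//.
  apply: segment_integrable => t.
  by apply: (@continuous_comp _ _ _ (fun t => c * t) h); [exact: cF|exact: ch].
- by rewrite ler_pM2r ?invr_gt0// (@le_trans _ _ 0) ?oppr_le0 ?ltW.
- by move=> s t _ _ st; rewrite ltr_pM2l.
- by move=> t _; exact: cvg_cst.
- exact: is_cvg_cst.
- exact: is_cvg_cst.
- split; [by move=> t _; have [] := dF t| |].
    exact/cvg_at_right_filter/cF.
  exact/cvg_at_left_filter/cF.
- exact: continuous_subspaceT.
Qed.

End integrals_on_the_line.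

(** * Fubini's theorem and slices of test functions *)

Section plane_integrals.
Variable R : realType.
Local Notation leb := (@lebesgue_measure R).
Implicit Types (F phi : R * R -> R) (M : R).

Lemma RintegralN d (T : measurableType d) (m : {measure set T -> \bar R}) (D : set T)
    (f : T -> R) : measurable D -> m.-integrable D (EFin \o f) ->
  \int[m]_(x in D) - f x = - \int[m]_(x in D) f x.
Proof.
move=> mD fi; under eq_Rintegral do rewrite -mulN1r.
by rewrite RintegralZl// mulN1r.
Qed.

(** A class on which Fubini's theorem holds in both orders and every slice, not just almost every
    one, is integrable. It admits discontinuous factors such as an indicator of one side of the
    diagonal. *)
Definition bounded_supp M F := [/\ measurable_fun (setT : set (mplane R)) F,
  exists C, forall x, `|F x| <= C &
  forall x, M <= `|x.1| \/ M <= `|x.2| -> F x = 0].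

Lemma bounded_supp_integrable M F : bounded_supp M F ->
  (leb2 R).-integrable setT (EFin \o F).
Proof.
move=> [mF [C FC] F0]; pose K : set (mplane R) := `[- M, M] `*` `[- M, M].
have mK : measurable K by exact: measurableX.
have -> : EFin \o F = (EFin \o F) \_ K.
  apply/funext => x; rewrite patchE; case: ifPn => //= /negP xK.
  rewrite F0//; have [|h1] := leP M `|x.1|; first by left.
  have [|h2] := leP M `|x.2|; first by right.
  by exfalso; apply: xK; rewrite inE; split; rewrite /= in_itv/= -ler_norml ltW.
apply: (@integrable_mkcond _ _ R (leb2 R) K (EFin \o F) mK).1.
apply: (@bounded_plane_integrable R _ K K F C) => //.
- by apply: leb2_compact; exact: box_compact.
- exact: measurable_funS mF.
Qed.

Lemma bounded_supp_slice0 M F t : bounded_supp M F ->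
  leb.-integrable setT (EFin \o (fun s => F (s, t))).
Proof.
move=> [mF [C FC] F0]; apply: (@integrable_supp _ _ M C) => //.
- exact: (measurable_fun_pair1 t mF).
- by move=> s sM; rewrite F0//; left.
Qed.

Lemma bounded_supp_slice1 M F s : bounded_supp M F ->
  leb.-integrable setT (EFin \o (fun t => F (s, t))).
Proof.
move=> [mF [C FC] F0]; apply: (@integrable_supp _ _ M C) => //.
- exact: (measurable_fun_pair2 s mF).
- by move=> t tM; rewrite F0//; right.
Qed.

(** Since every slice is integrable, the inner extended-real integral is finite and is recovered
    from its real value. *)
Lemma Rfubini0 M F : bounded_supp M F ->
  \int[leb2 R]_x F x = \int[leb]_t \int[leb]_s F (s, t).
Proof.
move=> bF; have := integral21_prod_meas1 (bounded_supp_integrable bF).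
rewrite /Rintegral /leb2 => <-; congr fine; apply: eq_integral => t _.
by rewrite /fubini_G fineK//; apply: integrable_fin_num => //; exact: bounded_supp_slice0 bF.
Qed.

Lemma Rfubini1 M F : bounded_supp M F ->
  \int[leb2 R]_x F x = \int[leb]_s \int[leb]_t F (s, t).
Proof.
move=> bF; have := integral12_prod_meas1 (bounded_supp_integrable bF).
rewrite /Rintegral /leb2 => <-; congr fine; apply: eq_integral => s _.
by rewrite /fubini_F fineK//; apply: integrable_fin_num => //; exact: bounded_supp_slice1 bF.
Qed.

Lemma test_continuous phi : test_function phi -> continuous phi.
Proof. by move=> [/(_ 0%N)[]]. Qed.

Lemma test_Rpos2 phi x : test_function phi -> ~ Rpos2 x -> phi x = 0.
Proof. by move=> [_ [K [_ KP phi0]]] nP; apply: phi0; apply: contra_not nP; exact: KP. Qed.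

Lemma test_supp phi : test_function phi -> exists M, forall x,
  M <= `|x.1| \/ M <= `|x.2| -> phi x = 0 /\ forall i, partial i phi x = 0.
Proof.
move=> tphi; have := tphi => -[Cphi [K [cK KP phi0]]].
have [M M0 KM] := compact_plane_box cK; exists M => x xM.
have nK : ~ K x by move=> /KM[h1 h2]; case: xM; rewrite leNgt ?h1 ?h2.
split; first exact: phi0.
by move=> i; exact: (partial_eq0 i cK phi0).
Qed.

Lemma test_bounded phi : test_function phi -> exists C, forall x, `|phi x| <= C.
Proof.
move=> tphi; have := tphi => -[Cphi [K [cK KP phi0]]].
have [C hC] := bounded_within_compact cK (continuous_subspaceT (test_continuous tphi)).
exists `|C| => x; have [Kx|/phi0 ->] := pselect (K x); last by rewrite normr0.
by rewrite (le_trans (hC _ Kx))// ler_norm.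
Qed.

Lemma bounded_suppM M (g : R * R -> R) phi C :
  measurable_fun (setT : set (mplane R)) g ->
  (forall x, `|x.1| < M -> `|x.2| < M -> `|g x| <= C) -> test_function phi ->
  (forall x, M <= `|x.1| \/ M <= `|x.2| -> phi x = 0) ->
  bounded_supp M (fun x => g x * phi x).
Proof.
move=> mg gC tphi phi0; split.
- apply: measurable_funM => //; apply: continuous_plane_measurable.
  exact: test_continuous.
- have [D hD] := test_bounded tphi; exists (`|C| * D) => x; rewrite normrM.
  have D0 : 0 <= D by apply: le_trans (hD x).
  have [h1|h1] := leP M `|x.1|; first by rewrite phi0 ?normr0 ?mulr0 ?mulr_ge0//; left.
  have [h2|h2] := leP M `|x.2|; first by rewrite phi0 ?normr0 ?mulr0 ?mulr_ge0//; right.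
  by apply: ler_pM => //; rewrite (le_trans (gC _ h1 h2))// ler_norm.
- by move=> x /phi0 ->; rewrite mulr0.
Qed.

Lemma test_slice0 phi (t : R) : test_function phi ->
  (forall s : R, is_derive s 1 (fun s => phi (s, t)) (partial ord0 phi (s, t))) /\
  continuous (fun s => partial ord0 phi (s, t)).
Proof.
move=> tphi; split=> [s|].
  by apply: partial0_is_derive; case: tphi => /(_ 1%N)/is_Ck_derivable.
have cp := test_continuous (partial_test_function ord0 tphi).
move=> s; apply: (@continuous_comp _ _ _ (fun s => (s, t))); last exact: cp.
exact: (cvg_pair cvg_id (cvg_cst t)).
Qed.

Lemma test_slice1 phi (s : R) : test_function phi ->
  (forall t : R, is_derive t 1 (fun t => phi (s, t)) (partial ord_max phi (s, t))) /\
  continuous (fun t => partial ord_max phi (s, t)).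
Proof.
move=> tphi; split=> [t|].
  by apply: partial1_is_derive; case: tphi => /(_ 1%N)/is_Ck_derivable.
have cp := test_continuous (partial_test_function ord_max tphi).
move=> t; apply: (@continuous_comp _ _ _ (fun t => (s, t))); last exact: cp.
exact: (cvg_pair (cvg_cst s) cvg_id).
Qed.

End plane_integrals.

Section weak_derivatives_of_max.
Variables (R : realType) (alpha : R).
Hypothesis alpha0 : 0 < alpha.
Local Notation leb := (@lebesgue_measure R).
Local Notation k := (Num.sqrt (1 + alpha ^+ 2)).
Local Notation arc := (arc_length alpha).
Implicit Types (phi : R * R -> R).

(** Both components are 0 on the diagonal, a choice on a null set that agrees with the strict
    inequalities in [Gamma_ac]. *)
Definition grad_maxG (i : 'I_2) (x : R * R) : R :=
  if i == ord0 then (alpha * x.2 < x.1)%R%:R else alpha * (x.1 < alpha * x.2)%R%:R.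

Lemma continuous_maxG : continuous (maxG alpha).
Proof.
move=> x; apply: continuous_max; first exact: cvg_fst.
by apply: cvgMl_tmp; exact: cvg_snd.
Qed.

Lemma measurable_ltr_indicator (f g : R * R -> R) : continuous f -> continuous g ->
  measurable_fun (setT : set (mplane R)) (fun x => (f x < g x)%R%:R : R).
Proof.
move=> cf cg.
rewrite (_ : (fun x => _) = \1_((fun x => g x - f x) @^-1` [set y | 0 < y])).
  apply: measurable_indic; apply: open_plane_measurable.
  apply: open_comp; last exact: open_gt.
  by move=> x _; apply: cvgB; [exact: cg|exact: cf].
apply/funext => x; rewrite indicE; congr (nat_of_bool _)%:R; apply/idP/idP => /=.
  by rewrite inE/= subr_gt0.
by rewrite inE/= subr_gt0.
Qed.

Lemma measurable_grad_maxG i : measurable_fun (setT : set (mplane R)) (grad_maxG i).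
Proof.
have c1 : continuous (fun x : R * R => x.1) by move=> x; exact: cvg_fst.
have c2 : continuous (fun x : R * R => alpha * x.2).
  by move=> x; apply: cvgMl_tmp; exact: cvg_snd.
have m1 := measurable_ltr_indicator c2 c1; have m2 := measurable_ltr_indicator c1 c2.
rewrite /grad_maxG; case: (i == ord0) => //.
exact: (measurable_funM (@measurable_cst _ _ (mplane R) _ setT alpha) m2).
Qed.

Lemma grad_maxG_bounded i x : `|grad_maxG i x| <= 1 + alpha.
Proof.
rewrite /grad_maxG; case: (i == ord0).
  by case: (_ < _); rewrite ?normr1 ?normr0 ?ler_wpDr// ?ltW// ?addr_ge0// ltW.
rewrite normrM gtr0_norm//; case: (_ < _); rewrite ?normr1 ?normr0 ?mulr1 ?mulr0.
  by rewrite lerDr.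
by rewrite addr_ge0// ltW.
Qed.

Lemma maxG_bounded M x : `|x.1| < M -> `|x.2| < M -> `|maxG alpha x| <= (1 + alpha) * M.
Proof.
move=> h1 h2; have M0 : 0 <= M by apply: ltW; apply: le_lt_trans h1.
have a1 : `|x.1| <= (1 + alpha) * M.
  by rewrite mulrDl mul1r (le_trans (ltW h1))// lerDl mulr_ge0// ltW.
have a2 : `|alpha * x.2| <= (1 + alpha) * M.
  rewrite normrM gtr0_norm// mulrDl mul1r ler_wpDl// ler_pM2l//; exact: ltW.
by rewrite /maxG /Num.max; case: ifP.
Qed.

Lemma Rpos2_int (m : {measure set (mplane R) -> \bar R}) (g : R * R -> R) phi : test_function phi ->
  \int[m]_(x in @Rpos2 R) (g x * phi x) = \int[m]_x (g x * phi x).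
Proof.
move=> tphi; apply/esym/Rintegral_support => // x _ nP.
by rewrite (test_Rpos2 tphi nP) mulr0.
Qed.

Lemma ord2P (i : 'I_2) : i = ord0 \/ i = ord_max.
Proof. by case: i => -[|[|//]] h; [left|right]; exact: val_inj. Qed.

Lemma maxG_weak_gradient : weak_gradient (maxG alpha) grad_maxG.
Proof.
move=> i; split.
- exact: measurable_funTS (measurable_grad_maxG i).
- move=> A bA; apply: (@bounded_plane_integrable R _ A A _ (1 + alpha)) => //; try exact: bA.1.
  + exact: leb2_bounded_borel bA.
  + exact: measurable_funTS (measurable_grad_maxG i).
  + by move=> x _; exact: grad_maxG_bounded.
move=> phi tphi; have tdphi := partial_test_function i tphi.
rewrite !Rpos2_int//; have [M hM] := test_supp tphi.
have phi0 x : M <= `|x.1| \/ M <= `|x.2| -> phi x = 0 by move=> /hM[].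
have dphi0 x : M <= `|x.1| \/ M <= `|x.2| -> partial i phi x = 0 by move=> /hM[_]; exact.
have b1 : bounded_supp M (fun x => maxG alpha x * partial i phi x).
  apply: (@bounded_suppM R M _ _ ((1 + alpha) * M)) => //.
    by apply: continuous_plane_measurable; exact: continuous_maxG.
  exact: maxG_bounded.
have b2 : bounded_supp M (fun x => grad_maxG i x * phi x).
  apply: (@bounded_suppM R M _ _ (1 + alpha)) => //.
    exact: measurable_grad_maxG.
  by move=> x _ _; exact: grad_maxG_bounded.
have phi0' (s t : R) : M <= `|s| \/ M <= `|t| -> phi (s, t) = 0.
  exact: (phi0 (s, t)).
have dphi0' (s t : R) : M <= `|s| \/ M <= `|t| -> partial i phi (s, t) = 0.
  exact: (dphi0 (s, t)).
rewrite -RintegralN//; last exact: bounded_supp_integrable b2.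
have b3 : bounded_supp M (fun x => - (grad_maxG i x * phi x)).
  have [mF [C hC] F0] := b2; split.
  - exact: measurableT_comp.
  - by exists C => x; rewrite normrN.
  - by move=> x /F0 ->; rewrite oppr0.
have [Ei|Ei] := ord2P i; subst i.
  rewrite (Rfubini0 b1) (Rfubini0 b3); apply: eq_Rintegral => t _.
  have [D cD] := test_slice0 t tphi.
  (* On the line [x.2 = t] the kink is at [x.1 = alpha * t], which is also the constant value before
     it; the slope after it is 1. *)
  have := @Rintegral_ramp_deriv R _ _ M D cD _ _ 1 (alpha * t) (alpha * t).
  rewrite RintegralN//; last exact: bounded_supp_slice0 b2.
  move=> H; under eq_Rintegral => s _.
    rewrite (_ : maxG alpha (s, t) = 1 * Num.max (s - alpha * t) 0 + alpha * t); last first.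
      by rewrite /maxG/= !maxEle mul1r subr_le0; case: ifP; rewrite ?add0r ?subrK.
    over.
  rewrite H; first by under eq_Rintegral do rewrite mul1r.
  - by move=> s sM; apply: phi0'; left.
  - by move=> s sM; apply: dphi0'; left.
rewrite (Rfubini1 b1) (Rfubini1 b3); apply: eq_Rintegral => s _.
have [D cD] := test_slice1 s tphi.
(* On the line [x.1 = s] the value is [s] up to the kink at [x.2 = s / alpha], and the slope after
   it is [alpha]. *)
have := @Rintegral_ramp_deriv R _ _ M D cD _ _ alpha s (s / alpha).
rewrite RintegralN//; last exact: bounded_supp_slice1 b2.
have E t : (s / alpha < t) = (s < alpha * t) by rewrite ltr_pdivrMr// mulrC.
move=> H; under eq_Rintegral => t _.
  rewrite (_ : maxG alpha (s, t) = alpha * Num.max (t - s / alpha) 0 + s); last first.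
    rewrite /maxG/=; have [h|h] := ltP s (alpha * t).
      rewrite max_l; last by rewrite subr_ge0 ltW ?E.
      by rewrite mulrBr mulrCA mulfV ?gt_eqF// mulr1 subrK.
    by rewrite max_r ?mulr0 ?add0r// subr_le0 leNgt E -leNgt.
  over.
rewrite H; first by under eq_Rintegral do rewrite E.
- by move=> t tM; apply: phi0'; right.
- by move=> t tM; apply: dphi0'; right.
Qed.

(** The diagonal parametrised by its second coordinate; the whole line is allowed because test
    functions vanish outside the open quadrant. *)
Definition diag_integral phi := \int[leb]_t phi (alpha * t, t).

Let dn (i : 'I_2) : R := diag_normal alpha 0 i.

Lemma test_diag phi : test_function phi -> continuous (fun t : R => phi (alpha * t, t)).
Proof.
move=> /test_continuous cphi t.
apply: (@continuous_comp _ _ _ (fun t : R => (alpha * t, t))); last exact: cphi.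
have cm : alpha * u @[u --> t] --> alpha * t by apply: cvgMl_tmp; exact: cvg_id.
exact: (cvg_pair cm cvg_id).
Qed.

Lemma test_diag_integrable phi : test_function phi ->
  leb.-integrable setT (EFin \o (fun t => phi (alpha * t, t))).
Proof.
move=> tphi; have [M hM] := test_supp tphi; have [C hC] := test_bounded tphi.
apply: (@integrable_supp _ _ M C) => //.
- by apply: continuous_measurable_fun; exact: test_diag.
- by move=> t tM; have [] := hM (alpha * t, t) (or_intror tM).
Qed.

Lemma test_graph phi : test_function phi -> continuous (fun s : R => phi (s, s / alpha)).
Proof.
move=> /test_continuous cphi s.
apply: (@continuous_comp _ _ _ (fun s : R => (s, s / alpha))); last exact: cphi.
have cm : u / alpha @[u --> s] --> s / alpha by apply: cvgMr_tmp; exact: cvg_id.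
exact: (cvg_pair cvg_id cm).
Qed.

(** In the slices [x.1 = s] the diagonal appears as [(s, s / alpha)]. Returning to the parameter
    [t = s / alpha] yields the factor [alpha], which up to sign is the second entry of
    [diag_normal]. *)
Lemma diag_integral_graph phi : test_function phi ->
  \int[leb]_s phi (s, s / alpha) = alpha * diag_integral phi.
Proof.
move=> tphi; have [M hM] := test_supp tphi.
rewrite (@Rintegral_dilation R (fun s => phi (s, s / alpha)) M alpha)//.
- congr (_ * _); apply: eq_Rintegral => t _.
  by rewrite mulrAC mulfV ?mul1r ?gt_eqF.
- exact: test_graph.
- by move=> s sM; have [] := hM (s, s / alpha) (or_introl sM).
Qed.

Lemma test_graph_integrable phi : test_function phi ->
  leb.-integrable setT (EFin \o (fun s => phi (s, s / alpha))).
Proof.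
move=> tphi; have [M hM] := test_supp tphi; have [C hC] := test_bounded tphi.
apply: (@integrable_supp _ _ M C) => //.
- by apply: continuous_measurable_fun; exact: test_graph.
- by move=> s sM; have [] := hM (s, s / alpha) (or_introl sM).
Qed.

(** Slices are taken in the direction [j]. On each of them the indicator in [grad_maxG i] selects a
    half-line ending on the diagonal, and integrating the derivative leaves the value of [phi]
    there, with sign [-] for a right half-line and [+] for a left one. A factor [alpha] comes from
    [grad_maxG] when [i] is the second index, and from [diag_integral_graph] when [j] is; with these
    signs the four cases give [- dn i * dn j]. *)
Lemma grad_maxG_partial i j phi : test_function phi ->
  \int[leb2 R]_(x in @Rpos2 R) (grad_maxG i x * partial j phi x) =
  - (dn i * dn j * diag_integral phi).
Proof.
move=> tphi; have tdphi := partial_test_function j tphi.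
rewrite Rpos2_int//; have [M hM] := test_supp tphi.
have b : bounded_supp M (fun x => grad_maxG i x * partial j phi x).
  apply: (@bounded_suppM R M _ _ (1 + alpha)) => //.
  - exact: measurable_grad_maxG.
  - by move=> x _ _; exact: grad_maxG_bounded.
  - by move=> x /hM[_]; exact.
have phi0 (s t : R) : M <= `|s| \/ M <= `|t| -> phi (s, t) = 0.
  by move=> h; have [] := hM (s, t) h.
have dphi0 l (s t : R) : M <= `|s| \/ M <= `|t| -> partial l phi (s, t) = 0.
  by move=> h; have [_] := hM (s, t) h; exact.
have E s t : (alpha * t < s) = (t < s / alpha) by rewrite ltr_pdivlMr// mulrC.
have E' s t : (s < alpha * t) = (s / alpha < t) by rewrite ltr_pdivrMr// mulrC.
have b' : bounded_supp M (fun x => (x.1 < alpha * x.2)%R%:R * partial j phi x).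
  apply: (@bounded_suppM R M _ _ 1) => //.
  - apply: measurable_ltr_indicator; first by move=> x; exact: cvg_fst.
    by move=> x; apply: cvgMl_tmp; exact: cvg_snd.
  - by move=> x _ _; case: (_ < _); rewrite ?normr1 ?normr0.
  - by move=> x /hM[_]; exact.
have [Ej|Ej] := ord2P j; subst j.
  have S t := test_slice0 t tphi.
  have p0 (t s : R) : M <= `|s| -> phi (s, t) = 0 by move=> h; apply: phi0; left.
  have d0 (t s : R) : M <= `|s| -> partial ord0 phi (s, t) = 0.
    by move=> h; apply: dphi0; left.
  have G t := @Rintegral_gt_deriv R _ _ M (S t).1 (S t).2 (p0 t) (d0 t) (alpha * t).
  have L t := @Rintegral_lt_deriv R _ _ M (S t).1 (S t).2 (p0 t) (d0 t) (alpha * t).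
  rewrite (Rfubini0 b).
  have [Ei|Ei] := ord2P i; subst i; rewrite /dn /diag_normal !mxE/=.
    under eq_Rintegral do rewrite G.
    by rewrite !mul1r RintegralN//; exact: test_diag_integrable.
  under eq_Rintegral => t _.
    under eq_Rintegral do rewrite -mulrA.
    rewrite RintegralZl//; last exact: bounded_supp_slice0 b'.
    rewrite L; over.
  rewrite RintegralZl//; last exact: test_diag_integrable.
  by rewrite mulr1 mulNr opprK.
have S s := test_slice1 s tphi.
have p0 (s t : R) : M <= `|t| -> phi (s, t) = 0 by move=> h; apply: phi0; right.
have d0 (s t : R) : M <= `|t| -> partial ord_max phi (s, t) = 0.
  by move=> h; apply: dphi0; right.
have G s := @Rintegral_gt_deriv R _ _ M (S s).1 (S s).2 (p0 s) (d0 s) (s / alpha).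
have L s := @Rintegral_lt_deriv R _ _ M (S s).1 (S s).2 (p0 s) (d0 s) (s / alpha).
rewrite (Rfubini1 b).
have [Ei|Ei] := ord2P i; subst i; rewrite /dn /diag_normal !mxE/=.
  under eq_Rintegral do under eq_Rintegral do rewrite /grad_maxG/= E.
  under eq_Rintegral do rewrite L.
  by rewrite diag_integral_graph// mul1r mulNr opprK.
under eq_Rintegral => s _.
  under eq_Rintegral do rewrite -mulrA.
  rewrite RintegralZl//; last exact: bounded_supp_slice1 b'.
  under eq_Rintegral do rewrite /= E'.
  rewrite G mulrN -mulNr; over.
have ig := test_graph_integrable tphi.
by rewrite RintegralZl// diag_integral_graph//; ring.
Qed.

Lemma arc_Rintegral phi : test_function phi ->
  \int[arc]_(x in @Rpos2 R) phi x = k * diag_integral phi.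
Proof.
move=> tphi; have := tphi => -[_ [K [cK KP phi0]]].
have k0 : 0 < k := diag_norm_gt0 alpha.
have [M hM] := test_supp tphi; have [C hC] := test_bounded tphi.
have mK := compact_plane_measurable cK.
have mray := measurable_diag_ray alpha.
have mphi := continuous_plane_measurable (test_continuous tphi).
have -> : \int[arc]_(x in @Rpos2 R) phi x = \int[arc]_(x in K) phi x.
  by apply: Rintegral_support => // x _; exact: phi0.
pose J : set (measurableTypeR R) := diag_ray alpha @^-1` K.
have mJ : measurable J by exact: measurable_ray.
have JI : J `<=` `[0, +oo[.
  move=> s /KP/diag_ray_Rpos2 s0; rewrite /= in_itv/= andbT ltW//; exact: s0.
have JJ (B : set (measurableTypeR R)) : B `<=` J -> B `&` `[0, +oo[%classic = B.
  by move=> BJ; apply/setIidl; exact: subset_trans JI.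
have -> : \int[arc]_(x in K) phi x = \int[leb]_(s in J) phi (diag_ray alpha s).
  rewrite /Rintegral (@integral_pushforward _ _ _ _ _ _ mray
     (mrestr leb (measurable_itv `[0, +oo[)) K (EFin \o phi))//.
  - by congr fine; apply: eq_measure_integral => B mB BJ; rewrite /= /mrestr JJ.
  - exact/measurable_EFinP.
  - apply: measurable_bounded_integrable => //.
    + exact: (arc_compact alpha cK).
    + by apply: measurable_funTS; exact: (measurableT_comp mphi mray).
    + exists C; split; first exact: num_real.
      by move=> y Cy s _ /=; rewrite (le_trans (hC _))// ltW.
rewrite -(@Rintegral_support _ _ _ leb setT J (fun s => phi (diag_ray alpha s)))//; last first.
  by move=> s _; exact: phi0.
have hs (s : R) : diag_ray alpha s = (alpha * (k^-1 * s), k^-1 * s).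
  by rewrite /diag_ray; congr pair => /=; ring.
under eq_Rintegral do rewrite hs.
rewrite /diag_integral (@Rintegral_dilation R (fun t => phi (alpha * t, t)) M k^-1) ?invr_gt0//.
- by rewrite mulrA mulfV ?mul1r ?gt_eqF.
- exact: test_diag.
- by move=> t tM; have [] := hM (alpha * t, t) (or_intror tM).
Qed.

End weak_derivatives_of_max.

(** * The generator as a signed measure *)

Section signed_radon_operations.
Variable R : realType.
Implicit Types (A : set (mplane R)).

Lemma Rintegral_mscale d (T : measurableType d) (m : {measure set T -> \bar R})
    (r : {nonneg R}) (D : set T) (f : T -> R) : measurable D ->
  m.-integrable D (EFin \o f) ->
  \int[mscale r m]_(x in D) f x = r%:num * \int[m]_(x in D) f x.
Proof.
move=> mD fi; have mf := measurable_int _ fi.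
rewrite /Rintegral integralE [in RHS]integralE.
rewrite ge0_integral_mscale//; last exact: measurable_funepos.
rewrite ge0_integral_mscale//; last exact: measurable_funeneg.
have f1 : (\int[m]_(x in D) (EFin \o f)^\+ x)%E \is a fin_num.
  by apply: integrable_fin_num => //; exact: integrable_funepos.
have f2 : (\int[m]_(x in D) (EFin \o f)^\- x)%E \is a fin_num.
  by apply: integrable_fin_num => //; exact: integrable_funeneg.
by rewrite -muleBr ?fineM// ?fin_num_adde_defr// fin_numB f1 f2.
Qed.

Lemma radon_on_add (E : set (R * R)) (m1 m2 : {measure set (mplane R) -> \bar R}) :
  radon_on E m1 -> radon_on E m2 -> radon_on E (measure_add m1 m2).
Proof.
move=> [z1 f1] [z2 f2]; split.
  by rewrite [LHS]measure_addE z1 z2 adde0.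
move=> K cK KE; rewrite [X in (X < _)%E]measure_addE.
by rewrite lte_add_pinfty// ?f1 ?f2.
Qed.

Definition sr_add (E : set (R * R)) (M1 M2 : signed_radon E) : signed_radon E := SignedRadon
  (radon_on_add (sr_pos_radon M1) (sr_pos_radon M2))
  (radon_on_add (sr_neg_radon M1) (sr_neg_radon M2)).

Definition sr_opp (E : set (R * R)) (M : signed_radon E) : signed_radon E :=
  SignedRadon (sr_neg_radon M) (sr_pos_radon M).

Lemma sr_val_add (E : set (R * R)) (M1 M2 : signed_radon E) A : bounded_borel E A ->
  sr_val (sr_add M1 M2) A = sr_val M1 A + sr_val M2 A.
Proof.
move=> bA; rewrite /sr_val.
have -> : sr_pos (sr_add M1 M2) A = (sr_pos M1 A + sr_pos M2 A)%E.
  exact: measure_addE.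
have -> : sr_neg (sr_add M1 M2) A = (sr_neg M1 A + sr_neg M2 A)%E.
  exact: measure_addE.
rewrite !fineD; try exact: radon_on_fin (sr_pos_radon _) bA;
  try exact: radon_on_fin (sr_neg_radon _) bA.
by lra.
Qed.

Lemma sr_val_opp (E : set (R * R)) (M : signed_radon E) A : sr_val (sr_opp M) A = - sr_val M A.
Proof. by rewrite /sr_val /= opprB. Qed.

Lemma sr_val_setI (E : set (R * R)) (M : signed_radon E) A B : bounded_borel E A -> measurable B ->
  sr_val M A = sr_val M (A `&` B) + sr_val M (A `\` B).
Proof.
move=> bA mB; have mA := bA.1.
have mAB := measurableI _ _ mA mB; have mADB := measurableD mA mB.
have bI := bounded_borelS bA mAB (@subIsetl _ _ _).
have bD := bounded_borelS bA mADB (@subDsetl _ _ _).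
have split (m : {measure set (mplane R) -> \bar R}) : radon_on E m ->
    fine (m A) = fine (m (A `&` B)) + fine (m (A `\` B)).
  move=> rm; rewrite -fineD; [|exact: radon_on_fin rm _..].
  by rewrite addeC -measureDI.
rewrite /sr_val (split _ (sr_pos_radon M)) (split _ (sr_neg_radon M)).
by lra.
Qed.

Lemma density_radon (m : {measure set (mplane R) -> \bar R}) (h : mplane R -> R)
    (mh : measurable_fun (@Rplus2 R : set (mplane R)) h) :
  (forall A, bounded_borel (@Rplus2 R) A -> m.-integrable A (EFin \o h)) ->
  radon_on (@Rplus2 R) (pos_density m (@measurable_Rplus2 R) mh).
Proof.
move=> ih; split.
  apply: pos_density_eq0; first by apply: measurableC; exact: measurable_Rplus2.
  by rewrite setICl measure0.
move=> K cK KP; apply: pos_density_lty; first exact: compact_plane_measurable.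
rewrite setIidl//; apply: ih; split; first exact: compact_plane_measurable.
by exists K; split.
Qed.

(** Applied with [m] the Lebesgue measure for the drift and for [c + r G], and with [m] the arc
    length for the diagonal term. *)
Lemma density_signed_radon (m : {measure set (mplane R) -> \bar R}) (h : mplane R -> R) :
  measurable_fun (@Rplus2 R : set (mplane R)) h ->
  (forall A, bounded_borel (@Rplus2 R) A -> m.-integrable A (EFin \o h)) ->
  exists M : signed_radon (@Rplus2 R), forall A, bounded_borel (@Rplus2 R) A ->
    sr_val M A = \int[m]_(x in A) h x.
Proof.
move=> mh ih; have mhN := measurable_oppD mh.
have ihN A : bounded_borel (@Rplus2 R) A -> m.-integrable A (EFin \o (fun x => - h x)).
  by move=> /ih/integrableN.
exists (SignedRadon (density_radon mh ih) (density_radon mhN ihN)) => A bA.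
rewrite /sr_val/=; apply: pos_densityB; [exact: bA.1| |exact: ih].
by case: bA => _ [K [_ AK KP]]; exact: subset_trans KP.
Qed.

End signed_radon_operations.

Section coefficients.
Variable R : realType.
Implicit Types (A : set (mplane R)) (b : R * R -> 'rV[R]_2) (sig : R * R -> 'M[R]_2).

Lemma big_ord2 (V : nmodType) (F : 'I_2 -> V) : \sum_i F i = F ord0 + F ord_max.
Proof. by rewrite big_ord_recl big_ord1; congr (_ + F _); exact: val_inj. Qed.

Lemma continuous_entry m n (F : R * R -> 'M[R]_(m, n)) (D : set (R * R)) i j :
  {within D, continuous F} -> {within D, continuous (fun x => F x i j)}.
Proof.
move=> cF x; apply: (@continuous_comp (subspace D) _ _ F (fun M => M i j)).
  exact: cF.
exact: coord_continuous.
Qed.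

Lemma continuous_amat sig (D : set (R * R)) i j :
  {within D, continuous sig} -> {within D, continuous (fun x => amat sig x i j)}.
Proof.
move=> cs; have e l l' := @continuous_entry 2 2 sig D l l' cs.
rewrite (_ : (fun x => _) =
    fun x => sig x i ord0 * sig x j ord0 + sig x i ord_max * sig x j ord_max).
  by move=> x; apply: cvgD; apply: cvgM; exact: e.
by apply/funext => x; rewrite /amat !mxE big_ord2 !mxE.
Qed.

Lemma Rplus2_continuous_integrable (m : {measure set (mplane R) -> \bar R}) (f g : R * R -> R) C A :
  (forall K : set (R * R), compact K -> (m K < +oo)%E) ->
  {within @Rplus2 R, continuous f} -> measurable_fun (setT : set (mplane R)) g ->
  (forall x, `|g x| <= C) -> bounded_borel (@Rplus2 R) A ->
  m.-integrable A (EFin \o (fun x => f x * g x)).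
Proof.
move=> mfin cf mg gC [mA [K [cK AK KP]]].
have [D hD] := bounded_within_compact cK (continuous_subspaceW KP cf).
apply: (@bounded_plane_integrable R m A K _ (D * C)) => //.
- exact: compact_plane_measurable.
- exact: mfin.
- apply: measurable_funM; last exact: measurable_funTS.
  apply: (@measurable_funS _ _ _ _ (@Rplus2 R : set (mplane R))).
  + exact: measurable_Rplus2.
  + exact: subset_trans KP.
  + by apply: continuous_within_measurable => //; exact: closed_Rplus2.
- by move=> x /AK Kx; rewrite normrM ler_pM// hD.
Qed.

Lemma bounded_borel_measurable (f : R * R -> R) A :
  {within @Rplus2 R, continuous f} -> bounded_borel (@Rplus2 R) A -> measurable_fun A f.
Proof.
move=> cf [mA [K [cK AK KP]]].
apply: (@measurable_funS _ _ _ _ (@Rplus2 R : set (mplane R))).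
- exact: measurable_Rplus2.
- exact: subset_trans KP.
- by apply: continuous_within_measurable => //; exact: closed_Rplus2.
Qed.

Lemma bounded_borel_bounded (f : R * R -> R) A :
  {within @Rplus2 R, continuous f} -> bounded_borel (@Rplus2 R) A ->
  exists C, forall x, A x -> `|f x| <= C.
Proof.
move=> cf [mA [K [cK AK KP]]].
have [C hC] := bounded_within_compact cK (continuous_subspaceW KP cf).
by exists C => x /AK; exact: hC.
Qed.

(* The weak gradient and the distributional Hessian of [f] are unique, and the
   bounded Borel subsets of the open quadrant determine a Radon measure there. *)
Lemma generator_measure_unique b sig (f : R * R -> R) (M M' : signed_radon (@Rplus2 R)) :
  {within @Rplus2 R, continuous b} -> {within @Rplus2 R, continuous sig} ->
  generator_measure b sig f M -> generator_measure b sig f M' ->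
  forall A, bounded_borel (@Rplus2 R) A -> sr_val M A = sr_val M' A.
Proof.
move=> cb csig [g [H [wg hH MP Max]]] [g' [H' [wg' hH' MP' Max']]] A bA.
have mA := bA.1; have mP := @measurable_Rpos2 R.
have E B : bounded_borel (@Rpos2 R) B -> sr_val M B = sr_val M' B.
  move=> bB; have bB' := bounded_borelW bB.
  rewrite MP// MP'//; congr (_ + 2^-1 * _); last first.
    apply: eq_bigr => i _; apply: eq_bigr => j _.
    have ca := @continuous_amat sig _ i j csig.
    have [C hC] := bounded_borel_bounded ca bB'.
    exact: (hessian_measure_eq j i hH hH' bB (bounded_borel_measurable ca bB') hC).
  have BP : B `<=` @Rpos2 R by case: bB => _ [K [_ BK KP]]; exact: subset_trans KP.
  have md (g0 : 'I_2 -> R * R -> R) : weak_gradient f g0 ->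
      measurable_fun B (fun x => \sum_i b x 0 i * g0 i x).
    move=> wg0; under eq_fun do rewrite big_ord2.
    have mg i : measurable_fun B (g0 i).
      by have [mg _ _] := wg0 i; exact: measurable_funS mg.
    have mb i := bounded_borel_measurable (@continuous_entry 1 2 b _ 0 i cb) bB'.
    by apply: measurable_funD; apply: measurable_funM.
  rewrite /Rintegral; congr fine; apply: ae_eq_integral => //.
  - exact: bB.1.
  - by apply/measurable_EFinP; exact: md.
  - by apply/measurable_EFinP; exact: md.
  - have a0 := weak_gradient_ae_eq ord0 wg wg' bB.
    have a1 := weak_gradient_ae_eq ord_max wg wg' bB.
    apply: filterS2 a0 a1 => x h0 h1 Bx.
    have [/subr0_eq e0] := h0 Bx; have [/subr0_eq e1] := h1 Bx.
    by rewrite !big_ord2 e0 e1.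
(* The part of [A] in the open quadrant may accumulate at the axes and so fail to be [bounded_borel]
   there; [E] is therefore used on boxes only and extended by [eq_sr_val_boxes]. The rest of [A] has
   value 0 for both measures. *)
rewrite (sr_val_setI M bA mP) (sr_val_setI M' bA mP).
have mD := measurableD mA mP; have mI := measurableI _ _ mA mP.
have bD := bounded_borelS bA mD (@subDsetl _ _ _).
have bI := bounded_borelS bA mI (@subIsetl _ _ _).
have eD : (A `\` @Rpos2 R) `&` @Rpos2 R = set0 by rewrite setDE -setIA setICl setI0.
rewrite (Max _ bD eD) (Max' _ bD eD).
congr (_ + _); apply/(sr_val_eqE _ _ bI bI).
apply: eq_sr_val_boxes => //; first exact: sub_Rpos2_Rplus2.
move=> a' b' c d a0 c0; apply: E; exact: bounded_borel_box.
Qed.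

End coefficients.

(** * The Hessian measure and the generator of the maximum *)

Section generator_of_max.
Variables (R : realType) (alpha : R).
Hypothesis alpha0 : 0 < alpha.
Local Notation leb := (@lebesgue_measure R).
Local Notation k := (Num.sqrt (1 + alpha ^+ 2)).
Local Notation arc := (arc_length alpha).
Local Notation n := (diag_normal alpha).
Implicit Types (A : set (mplane R)).

Lemma maxr0_ge0 (x : R) : 0 <= Num.max x 0.
Proof. by rewrite le_max lexx orbT. Qed.

Lemma scaled_arc_radon (x : R) :
  radon_on (@Rpos2 R) (mscale (NngNum (maxr0_ge0 x)) arc).
Proof.
have [z f] := arc_radon_Rpos2 alpha0; split.
  by rewrite -[LHS]/((Num.max x 0)%:E * arc (~` @Rpos2 R))%E z mule0.
move=> K cK KP; rewrite -[ltLHS]/((Num.max x 0)%:E * arc K)%E.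
by rewrite lte_mul_pinfty// ?lee_fin ?maxr0_ge0// f.
Qed.

(** The constant [n_i n_j / k] is negative for [i != j], so its positive and negative parts, at
    least one of them 0, scale the two halves of the pair. *)
Definition maxG_hessian (i j : 'I_2) : signed_radon (@Rpos2 R) :=
  SignedRadon (scaled_arc_radon (n 0 i * n 0 j / k))
    (scaled_arc_radon (- (n 0 i * n 0 j / k))).

Lemma sr_int_maxG_hessian i j A f : measurable A -> arc.-integrable A (EFin \o f) ->
  sr_int (maxG_hessian i j) A f = n 0 i * n 0 j / k * \int[arc]_(x in A) f x.
Proof.
move=> mA fi; rewrite /sr_int /= !Rintegral_mscale//= -mulrBl; congr (_ * _).
by rewrite !maxEle oppr_le0; case: leP => ?; case: leP => ?; lra.
Qed.

(** The weak gradient is tested against [partial j phi], which is again a test function, and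
    [grad_maxG_partial] removes the remaining derivative. The two minus signs cancel, and the [k] of
    [arc_Rintegral] cancels the one in the denominator of [maxG_hessian]. *)
Lemma maxG_hessian_measure : hessian_measure (maxG alpha) maxG_hessian.
Proof.
move=> i j phi tphi; have tdphi := partial_test_function j tphi.
have [_ _ ->//] := maxG_weak_gradient alpha0 i.
rewrite grad_maxG_partial// opprK.
have := tphi => -[_ [K [cK KP phi0]]].
have mK := compact_plane_measurable cK.
have ic : arc.-integrable K (EFin \o phi).
  apply: (@compact_plane_integrable R arc K K) => //; first exact: arc_compact.
  by apply: continuous_subspaceT; exact: test_continuous.
have -> : sr_int (maxG_hessian i j) (@Rpos2 R) phi = sr_int (maxG_hessian i j) K phi.
  by rewrite /sr_int; congr (_ - _); apply: Rintegral_support => // x _; exact: phi0.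
rewrite sr_int_maxG_hessian//.
rewrite -(@Rintegral_support _ _ _ arc (@Rpos2 R) K)//; last by move=> x _; exact: phi0.
by rewrite arc_Rintegral// mulrA divfK// gt_eqF// diag_norm_gt0.
Qed.

Variables (b : R * R -> 'rV[R]_2) (sig : R * R -> 'M[R]_2).
Hypotheses (cb : {within @Rplus2 R, continuous b}) (csig : {within @Rplus2 R, continuous sig}).

Let drift (x : mplane R) : R := \sum_i b x 0 i * grad_maxG alpha i x.

(** The trace of [a n^T n] is the quadratic form [n a n^T]. In the denominator [2 k], the 2 comes
    from the generator and the [k] from the Hessian measure; the index order is that of the trace in
    [generator_measure]. *)
Lemma Gamma_diagE x : Gamma_diag alpha sig x =
  - (2^-1 * \sum_i \sum_j (n 0 j * n 0 i / k * amat sig x i j)).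
Proof.
have k0 : k != 0 by rewrite gt_eqF// diag_norm_gt0.
rewrite /Gamma_diag; move: (amat sig x) => a; congr (- _).
rewrite !mxE !big_ord2 !mxE !big_ord2 /diag_normal !mxE /=.
by field.
Qed.

Let ca i j := @continuous_amat R sig _ i j csig.
Let cbi i := @continuous_entry R 1 2 b _ 0 i cb.

Lemma continuous_Gamma_diag : {within @Rplus2 R, continuous (Gamma_diag alpha sig)}.
Proof.
pose e i j x := n 0 j * n 0 i / k * amat sig x i j.
have ce i j : {within @Rplus2 R, continuous (e i j)}.
  by move=> x; apply: cvgMl_tmp; exact: ca.
rewrite (_ : Gamma_diag alpha sig = fun x => - (2^-1 * (e ord0 ord0 x + e ord0 ord_max x +
    (e ord_max ord0 x + e ord_max ord_max x)))).
  by move=> x; apply: cvgN; apply: cvgMl_tmp; apply: cvgD; apply: cvgD; exact: ce.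
by apply/funext => x; rewrite Gamma_diagE !big_ord2.
Qed.

Lemma arc_integrable (f : R * R -> R) A : {within @Rplus2 R, continuous f} ->
  bounded_borel (@Rplus2 R) A -> arc.-integrable A (EFin \o f).
Proof.
move=> cf [mA [K [cK AK KP]]].
apply: (compact_plane_integrable mA cK AK); first exact: arc_compact.
exact: continuous_subspaceW KP cf.
Qed.

Lemma leb2_integrable (f : R * R -> R) A : {within @Rplus2 R, continuous f} ->
  bounded_borel (@Rplus2 R) A -> (leb2 R).-integrable A (EFin \o f).
Proof.
move=> cf [mA [K [cK AK KP]]].
apply: (compact_plane_integrable mA cK AK); first exact: leb2_compact.
exact: continuous_subspaceW KP cf.
Qed.

Lemma drift_integrable A : bounded_borel (@Rplus2 R) A ->
  (leb2 R).-integrable A (EFin \o drift).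
Proof.
move=> bA; have mA := bA.1.
have ii i : (leb2 R).-integrable A (EFin \o (fun x => b x 0 i * grad_maxG alpha i x)).
  apply: (@Rplus2_continuous_integrable R _ _ _ (1 + alpha)) bA.
  - exact: leb2_compact.
  - exact: cbi.
  - exact: measurable_grad_maxG.
  - exact: grad_maxG_bounded.
rewrite (_ : EFin \o drift = EFin \o (fun x => b x 0 ord0 * grad_maxG alpha ord0 x +
  b x 0 ord_max * grad_maxG alpha ord_max x)); last first.
  by apply/funext => x; rewrite /drift /= big_ord2.
exact: (integrableD mA (ii ord0) (ii ord_max)).
Qed.

Lemma measurable_drift : measurable_fun (@Rplus2 R : set (mplane R)) drift.
Proof.
rewrite (_ : drift = (fun x => b x 0 ord0 * grad_maxG alpha ord0 x +
  b x 0 ord_max * grad_maxG alpha ord_max x)); last first.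
  by apply/funext => x; rewrite /drift big_ord2.
have m i : measurable_fun (@Rplus2 R : set (mplane R)) (fun x => b x 0 i).
  by apply: continuous_within_measurable; [exact: closed_Rplus2|exact: cbi].
have mg i := measurable_grad_maxG alpha i.
by apply: measurable_funD; apply: measurable_funM => //; exact: measurable_funTS.
Qed.

(** [Gamma_diag] already carries the sign of [- LG], hence the subtraction. The clause on sets
    missing the open quadrant holds because such sets are null for both Lebesgue measure and arc
    length. *)
Lemma maxG_generator_measure_exists : exists2 M : signed_radon (@Rplus2 R),
  generator_measure b sig (maxG alpha) M &
  forall A, bounded_borel (@Rplus2 R) A -> sr_val M A =
    \int[leb2 R]_(x in A) drift x - \int[arc]_(x in A) Gamma_diag alpha sig x.
Proof.
have [M1 hM1] := density_signed_radon measurable_drift drift_integrable.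
have cG := continuous_Gamma_diag.
have mG : measurable_fun (@Rplus2 R : set (mplane R)) (Gamma_diag alpha sig).
  by apply: continuous_within_measurable; [exact: closed_Rplus2|exact: cG].
have [M2 hM2] := density_signed_radon mG (fun A => arc_integrable cG).
have hM A : bounded_borel (@Rplus2 R) A -> sr_val (sr_add M1 (sr_opp M2)) A =
    \int[leb2 R]_(x in A) drift x - \int[arc]_(x in A) Gamma_diag alpha sig x.
  by move=> bA; rewrite sr_val_add// sr_val_opp hM1// hM2.
exists (sr_add M1 (sr_opp M2)) => //.
exists (grad_maxG alpha), maxG_hessian; split.
- exact: maxG_weak_gradient.
- exact: maxG_hessian_measure.
- move=> A /bounded_borelW bA; have mA := bA.1; rewrite hM//; congr (_ + _).
  have ia i j := arc_integrable (@ca i j) bA.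
  rewrite !big_ord2 !sr_int_maxG_hessian//.
  (* The entries [e], their row sums [s] and the total [t] are shown integrable in turn, so that the
     double sum of integrals becomes the integral of [Gamma_diag]. *)
  pose e i j : mplane R -> R := fun x => n 0 j * n 0 i / k * amat sig x i j.
  have ie i j : arc.-integrable A (EFin \o e i j).
    exact: (integrableZl mA (n 0 j * n 0 i / k) (ia i j)).
  have eE i j : \int[arc]_(x in A) e i j x =
      n 0 j * n 0 i / k * \int[arc]_(x in A) amat sig x i j.
    by apply: RintegralZl => //; exact: ia.
  pose s i : mplane R -> R := fun x => e i ord0 x + e i ord_max x.
  have iss i : arc.-integrable A (EFin \o s i) by exact: (integrableD mA (ie _ _) (ie _ _)).
  have sE i : \int[arc]_(x in A) s i x =
      \int[arc]_(x in A) e i ord0 x + \int[arc]_(x in A) e i ord_max x.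
    exact: RintegralD.
  pose t : mplane R -> R := fun x => s ord0 x + s ord_max x.
  have it : arc.-integrable A (EFin \o t) by exact: (integrableD mA (iss _) (iss _)).
  have tE : \int[arc]_(x in A) t x = \int[arc]_(x in A) s ord0 x + \int[arc]_(x in A) s ord_max x.
    exact: RintegralD.
  have GE : \int[arc]_(x in A) Gamma_diag alpha sig x = \int[arc]_(x in A) (- 2^-1 * t x).
    by apply: eq_Rintegral => x _; rewrite Gamma_diagE !big_ord2 mulNr.
  have -> : \int[arc]_(x in A) Gamma_diag alpha sig x = - 2^-1 * \int[arc]_(x in A) t x.
    by rewrite GE; exact: RintegralZl.
  by rewrite mulNr opprK tE !sE !eE.
- move=> A bA A0; rewrite hM//; have mA := bA.1.
  have AP : A `<=` @Rplus2 R by case: bA => _ [K [_ AK KP]]; exact: subset_trans KP.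
  have := drift_integrable bA; have := arc_integrable cG bA.
  move=> /measurable_int mG' /measurable_int md'.
  rewrite /Rintegral (null_set_integral mA md' (leb2_axes mA AP A0)).
  by rewrite (null_set_integral mA mG' (arc_offRpos2 alpha0 mA A0)) subrr.
Qed.

Lemma Gamma_acE (c : R * R -> R) (r : R) x :
  Gamma_ac alpha b c r x = c x + r * maxG alpha x - drift x.
Proof.
rewrite /Gamma_ac /drift big_ord2 /grad_maxG /=.
by case: (_ < _); case: (_ < _) => /=; ring.
Qed.

End generator_of_max.

(** [Gamma] is built from the given [LG], so its defining identity holds by construction; the
    explicit representative serves to evaluate [LG] on bounded sets, through uniqueness. The two
    restricted formulas follow from the full one, since the diagonal is Lebesgue null and its
    complement is null for arc length. *)
Theorem theorem3p1 (R : realType) (d : measure_display) (Om : measurableType d)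
    (P : probability Om R) (W : R -> Om -> R * R)
    (b : R * R -> 'rV[R]_2) (sig : R * R -> 'M[R]_2) (c : R * R -> R)
    (r alpha : R) :
  0 < alpha ->
  brownian_motion P W ->
  standing_assumptions P W b sig c r (maxG alpha) ->
  (exists LG, generator_measure b sig (maxG alpha) LG) /\
  forall LG, generator_measure b sig (maxG alpha) LG ->
  exists Gamma : signed_radon (@Rplus2 R),
  [/\ forall A, bounded_borel (@Rplus2 R) A ->
        sr_val Gamma A =
        \int[leb2 R]_(x in A) (c x + r * maxG alpha x) - sr_val LG A,
      forall A, bounded_borel (@Rplus2 R) A ->
        (leb2 R).-integrable A (EFin \o Gamma_ac alpha b c r) /\
        (arc_length alpha).-integrable A (EFin \o Gamma_diag alpha sig),
      forall A, bounded_borel (@Rplus2 R) A -> A `<=` ~` Diag alpha ->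
        sr_val Gamma A = \int[leb2 R]_(x in A) Gamma_ac alpha b c r x,
      leb2 R (Diag alpha) = 0%E /\
      forall A, bounded_borel (@Rplus2 R) A -> A `<=` Diag alpha ->
        sr_val Gamma A = \int[arc_length alpha]_(x in A) Gamma_diag alpha sig x &
      forall A, bounded_borel (@Rplus2 R) A ->
        sr_val Gamma A =
        \int[leb2 R]_(x in A) Gamma_ac alpha b c r x +
        \int[arc_length alpha]_(x in A) Gamma_diag alpha sig x].
Proof.
move=> alpha0 _ [[[cb csig _ _] _ _ _] [_ cc _ _ _] _].
have [M0 gM0 hM0] := maxG_generator_measure_exists alpha0 cb csig.
split; first by exists M0.
move=> LG gLG.
have cG : {within @Rplus2 R, continuous (fun x => c x + r * maxG alpha x)}.
  move=> x; apply: cvgD; first exact: cc.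
  apply: cvgMl_tmp; have := continuous_subspaceT (@continuous_maxG R alpha); exact.
have mG : measurable_fun (@Rplus2 R : set (mplane R)) (fun x => c x + r * maxG alpha x).
  by apply: continuous_within_measurable; [exact: closed_Rplus2|exact: cG].
have [M1 hM1] := density_signed_radon mG (fun A => leb2_integrable cG).
have iac A : bounded_borel (@Rplus2 R) A ->
    (leb2 R).-integrable A (EFin \o Gamma_ac alpha b c r).
  move=> bA; rewrite (_ : EFin \o _ = EFin \o (fun x => c x + r * maxG alpha x -
      \sum_i b x 0 i * grad_maxG alpha i x)); last first.
    by apply/funext => x /=; rewrite Gamma_acE.
  exact: (integrableB bA.1 (leb2_integrable cG bA) (drift_integrable alpha0 cb bA)).
have idiag A : bounded_borel (@Rplus2 R) A ->
    (arc_length alpha).-integrable A (EFin \o Gamma_diag alpha sig).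
  by move=> bA; apply: arc_integrable bA => //; exact: continuous_Gamma_diag.
pose Gamma := sr_add M1 (sr_opp LG).
have GE A : bounded_borel (@Rplus2 R) A -> sr_val Gamma A =
    \int[leb2 R]_(x in A) (c x + r * maxG alpha x) - sr_val LG A.
  by move=> bA; rewrite sr_val_add// sr_val_opp hM1.
have main A : bounded_borel (@Rplus2 R) A -> sr_val Gamma A =
    \int[leb2 R]_(x in A) Gamma_ac alpha b c r x +
    \int[arc_length alpha]_(x in A) Gamma_diag alpha sig x.
  move=> bA; rewrite GE// (generator_measure_unique cb csig gLG gM0 bA) hM0//.
  (* Subtracting [LG] turns the diagonal term positive and leaves the drift to be merged with
     [c + r G] into [Gamma_ac]. *)
  rewrite opprB addrCA addrC; congr (_ + _).
  rewrite -RintegralB//; [|exact: bA.1|exact: leb2_integrable cG bA|exact: drift_integrable bA].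
  by apply: eq_Rintegral => x _; rewrite Gamma_acE.
exists Gamma; split => //.
- by move=> A bA; split; [exact: iac|exact: idiag].
- move=> A bA AD; rewrite main// [X in _ + X](_ : _ = 0) ?addr0//.
  rewrite /Rintegral null_set_integral//; [exact: bA.1|exact: measurable_int (idiag _ bA)|].
  exact: arc_offDiag.
- split; first exact: leb2_Diag.
  move=> A bA AD; rewrite main// [X in X + _](_ : _ = 0) ?add0r//.
  rewrite /Rintegral null_set_integral//; [exact: bA.1|exact: measurable_int (iac _ bA)|].
  apply: (@subset_measure0 _ _ _ (leb2 R) A (Diag alpha)) => //.
  + exact: bA.1.
  + exact: measurable_Diag.
  + exact: leb2_Diag.
Qed.
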